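(* Fix $n\in\mathbb N_0$. Suppose $(\tau_0-E)u=0$ has a positive solution and let $u_0$ be a minimal positive solution. Define $v_0$ by $$v_0(x)=u_0(x)\int_a^x\frac{dt}{p_0(t)u_0(t)^2},$$ and suppose that, as $x\to b$, $$p_0v_0\,p_0u_0'\,\Delta p=o\Big(\frac{(v_0/u_0)^2}{L_n(v_0/u_0)^2}\Big),\qquad p_0\,\Delta p=o\Big(\frac{(v_0/u_0)^2}{L_n(v_0/u_0)^2}\Big).$$ Then $\tau_1-E$ is oscillatory if $$\limsup_{x\to b}\,L_n\Big(\frac{v_0}{u_0}\Big)^2\left(p_0u_0^2\big(u_0^2\,\Delta q+(p_0u_0')^2\,\Delta p\big)-Q_n\Big(\frac{v_0}{u_0}\Big)\right)<-\frac14$$ and nonoscillatory if $$\liminf_{x\to b}\,L_n\Big(\frac{v_0}{u_0}\Big)^2\left(p_0u_0^2\big(u_0^2\,\Delta q+(p_0u_0')^2\,\Delta p\big)-Q_n\Big(\frac{v_0}{u_0}\Big)\right)>-\frac14 .$$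
   Context: Let $-\infty<a<b\le\infty$ and $\tau_j=\frac1r\left(-\frac{d}{dx}p_j\frac{d}{dx}+q_j\right)$, $j=0,1$, on $(a,b)$, where the coefficients are real-valued with $p_j^{-1},q_j,r\in L^1_{loc}(a,b)$ and $p_j,r>0$. Standing assumptions: for both $\tau_0$ and $\tau_1$ the endpoint $a\in\mathbb R$ is regular (i.e. $q_j,p_j^{-1},r$ are integrable near $a$) and $b$ is limit point (i.e. $(\tau_j-z)u=0$ has, up to multiples, at most one solution which is in $L^2(r\,dx)$ near $b$). $E\in\mathbb R$. Notation: $\Delta p=\frac1{p_0}-\frac1{p_1}$, $\Delta q=q_1-q_0$. A positive solution $u_0$ of $(\tau_0-E)u_0=0$ is called minimal (principal) near $b$ if $\int^b\frac{dt}{p_0(t)u_0(t)^2}=\infty$. $\tau_1-E$ is called nonoscillatory if one (equivalently, every) nontrivial solution of $(\tau_1-E)u=0$ has finitely many zeros in $(a,b)$, and oscillatory otherwise. Iterated logarithms: $\log_0(x)=x$, $\log_n(x)=\log(\log_{n-1}(x))$, with the convention $\log(x)=\log|x|$ for negative $x$. $L_n(x)=\frac{1}{\log_{n+1}'(x)}=\prod_{j=0}^n\log_j(x)$ and $Q_n(x)=-\frac14\sum_{j=0}^{n-1}\frac1{L_j(x)^2}$, with $Q_0=0$. $\mathbb N_0=\{0,1,2,\dots\}$. *)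

(* Defs.v *)
From HB Require Import structures.
From mathcomp Require Import all_boot all_order all_algebra.
From mathcomp.real_closed Require Import complex.
From mathcomp Require Import all_classical all_reals all_analysis.

Set Implicit Arguments.
Unset Strict Implicit.
Unset Printing Implicit Defensive.

Import Order.TTheory GRing.Theory Num.Theory.
Import numFieldNormedType.Exports.

Local Open Scope classical_set_scope.
Local Open Scope ring_scope.

Section SturmLiouville.
Context {R : realType}.
Local Notation mu := (@lebesgue_measure R).
Implicit Types (a E : R) (b : \bar R) (I : set R) (p q r u f : R -> R).


Definition oo_itv a b : set R := [set x | a < x /\ (x%:E < b)%E].

(* The left neighbourhoods of b up to Lebesgue null sets. The coefficients and
   p u' are only determined almost everywhere, so limits as x -> b are taken
   along this filter; the limsup along it is the essential one. Anything that
   holds pointwise near b also holds along this filter. *)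
Definition ae_at_left b : set_system R :=
  [set A | exists2 U, nbhs b U &
     {ae mu, forall x, U x%:E -> (x%:E < b)%E -> A x}].

Lemma ae_at_left_filter b : Filter (ae_at_left b).
Proof.
have aeF : Filter (almost_everywhere mu) by exact: ae_filter_ringOfSetsType.
split=> [|A B [U bU UA] [V bV VB]|A B AB [U bU UA]].
- by exists setT; [exact: filterT|exact: aeW].
- exists (U `&` V); first exact: filterI.
  by apply: filterS2 UA VB => x UA VB [Ux Vx] xb; split; [exact: UA|exact: VB].
- by exists U => //; apply: filterS UA => x UA Ux xb; apply: AB; exact: UA.
Qed.

Canonical ae_at_left_filter_on b :=
  FilterType (ae_at_left b) (ae_at_left_filter b).

(* Locally absolutely continuous: an indefinite integral of a locally integrable
   function (which is then the derivative almost everywhere). *)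
Definition ac_loc I f := exists2 g : R -> R, locally_integrable I g &
  forall c d, `[c, d] `<=` I -> c <= d -> f d - f c = \int[mu]_(t in `[c, d]) g t.

(* - (p u')' + q u = f on I; w is the locally absolutely continuous
   representative of p u'. Both u and w are derivable almost everywhere. *)
Definition sl_eq I p q u f := exists w : R -> R,
  [/\ ac_loc I u, ac_loc I w,
      {ae mu, forall x, I x -> w x = p x * derive1 u x} &
      {ae mu, forall x, I x -> - derive1 w x + q x * u x = f x}].

(* (tau - E) u = 0 with tau = r^-1 (- d/dx p d/dx + q), u real-valued. *)
Definition sl_solution I p q r E u :=
  sl_eq I p q u (fun x => r x * (E * u x)).

(* (tau - z) u = 0 for complex z and complex-valued u, componentwise. *)
Definition sl_csolution I p q r (z : R[i]) (u : R -> R[i]) :=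
  sl_eq I p q (fun x => complex.Re (u x)) (fun x => r x * complex.Re (z * u x)) /\
  sl_eq I p q (fun x => complex.Im (u x)) (fun x => r x * complex.Im (z * u x)).

Definition sl_coefficients a b p q r :=
  {ae mu, forall x, oo_itv a b x -> 0 < p x /\ 0 < r x} /\
  [/\ locally_integrable (oo_itv a b) (fun x => (p x)^-1),
      locally_integrable (oo_itv a b) q &
      locally_integrable (oo_itv a b) r].

Definition regular_left a b p q r := exists2 c, oo_itv a b c &
  [/\ mu.-integrable `]a, c[ (fun x => ((p x)^-1)%:E),
      mu.-integrable `]a, c[ (fun x => (q x)%:E) &
      mu.-integrable `]a, c[ (fun x => (r x)%:E)].

Definition L2_near a b r (u : R -> R[i]) := exists2 c, oo_itv a b c &
  (\int[mu]_(x in oo_itv c b)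
     (r x * (complex.Re (u x) ^+ 2 + complex.Im (u x) ^+ 2))%:E < +oo)%E.

Definition limit_point_right a b p q r :=
  forall (z : R[i]) (u1 u2 : R -> R[i]),
    sl_csolution (oo_itv a b) p q r z u1 -> L2_near a b r u1 ->
    sl_csolution (oo_itv a b) p q r z u2 -> L2_near a b r u2 ->
  exists2 k : R[i] * R[i], k != (0, 0) &
    forall x, oo_itv a b x -> k.1 * u1 x + k.2 * u2 x = 0.

(* u is real-valued here: a complex solution need not have zeros. *)
Definition nonoscillatory a b p q r E := exists u,
  [/\ sl_solution (oo_itv a b) p q r E u,
      exists2 x, oo_itv a b x & u x != 0 &
      finite_set (oo_itv a b `&` [set x | u x = 0])].

Definition oscillatory a b p q r E := ~ nonoscillatory a b p q r E.

Definition minimal_positive_solution a b p q r E u :=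
  [/\ sl_solution (oo_itv a b) p q r E u,
      forall x, oo_itv a b x -> 0 < u x &
      forall c, oo_itv a b c ->
        (\int[mu]_(t in oo_itv c b) ((p t * u t ^+ 2)^-1)%:E = +oo)%E].

(* A real-valued integral: meaningful only when it converges at a. *)
Definition second_solution a p u : R -> R := fun x =>
  u x * \int[mu]_(t in `]a, x[) (p t * u t ^+ 2)^-1.

(* log x stands for log |x| when x < 0. *)
Definition iterlog (n : nat) (x : R) : R := iter n (fun y => ln `|y|) x.

Definition Llog (n : nat) (x : R) : R := \prod_(j < n.+1) iterlog j x.

Definition Qlog (n : nat) (x : R) : R :=
  - (1 / 4) * \sum_(j < n) (Llog j x ^+ 2)^-1.

End SturmLiouville.

(* Main.v *)
Require Import Defs.
From mathcomp Require Import all_boot all_order all_algebra ring lra.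
From mathcomp Require Import all_classical all_reals all_analysis measurable_realfun.
Import Order.TTheory GRing.Theory Num.Theory.
Import numFieldNormedType.Exports.
Set Implicit Arguments.
Unset Strict Implicit.
Unset Printing Implicit Defensive.
Local Open Scope classical_set_scope.
Local Open Scope ring_scope.

(** The idea of the proof.

Let w0 = p0 u0' and s = v0/u0.  Then s' = 1/(p0 u0^2), and s tends to infinity
at b because u0 is minimal.  For a solution u of the perturbed equation with
w = p1 u', put Y = u/u0 and Z = u0 w - w0 u.  In the variable s these solve
    dY/ds = (1 - A) Z - B Y,      dZ/ds = B Z + C Y
with A = p0 Dp, B = p0 u0 w0 Dp, C = p0 u0^2 (u0^2 Dq + w0^2 Dp)
(comparison_system): a perturbation of d^2Y/ds^2 = C Y, and Y has the zeros
of u.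

The borderline equation is y'' = Q_{n+1}(s) y.  It has the solution
sqrt(L_n), whose logarithmic derivative psi = 1/2 sum_{j<=n} 1/L_j satisfies
psi' + psi^2 = Q_{n+1} = Q_n - 1/(4 L_n^2) (ac_derive_psi_log).  The limsup
and liminf conditions say that L_n^2 (C - Q_{n+1}) is eventually below a
negative, respectively above a positive, constant.  Since
0 <= s psi <= n+1 and s <= L_n, the two smallness hypotheses on Dp make the
terms with A and B negligible against 1/L_n^2 (comparison_lower and
comparison_upper).

Nonoscillation (nonoscillation_criterion).  With W = Z - psi Y,
    d(Y W)/ds = (1 - A) W^2 + (C - Q_{n+1} + 2 B psi + A psi^2) Y^2 >= 0,
because 1 - A = p0/p1 > 0.  A solution for which Y W is positive at one point
close to b therefore has no zero to its right (nonvanishing_product).  To its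
left there are finitely many zeros, since at the regular endpoint a the pair
(u, w) extends continuously without vanishing (system_zeros_finite).

Oscillation (oscillation_criterion).  If u had no zeros near b, then
h = L_n (Z/Y - psi) would satisfy dh/ds <= - m (1 + h^2)/L_n for some m > 0.
As log_{n+1}(s) has derivative 1/L_n, the function atan h + m log_{n+1}(s)
would be nonincreasing, although log_{n+1}(s) is unbounded
(riccati_atan_bound).

The coefficients are only locally integrable, so derivatives exist only almost
everywhere.  Two facts make the computations above legitimate: an absolutely
continuous function whose derivative is nonpositive almost everywhere is
nonincreasing (ac_derive_nonincreasing), and a linear system with integrable
coefficients can be solved from its regular endpoint (linear_ivp). *)

(** * Absolutely continuous functions *)
Section AbsolutelyContinuous.
Context {R : realType}.
Local Notation mu := (@lebesgue_measure R).
Implicit Types (c d x y : R) (f g : R -> R).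

(** Domination of the increments by the integral of one integrable function is
equivalent to absolute continuity, and is inherited by sums, products and
compositions through pointwise estimates of increments. *)
Definition abs_continuous c d f := exists2 g : R -> R,
  mu.-integrable setT (EFin \o g) & (forall t, 0 <= g t) /\
  forall x y, c <= x -> x <= y -> y <= d ->
    `|f y - f x| <= \int[mu]_(t in `[x, y]) g t.

(** The derivative is an explicit function, so that the rules of calculus
compute it; it matters only up to null sets (see ac_derive_ae). *)
Definition ac_derive c d f f' := abs_continuous c d f /\
  {ae mu, forall x, c < x < d -> is_derive x 1 f (f' x)}.

Lemma aeS (P Q : R -> Prop) : (forall x, P x -> Q x) ->
  {ae mu, forall x, P x} -> {ae mu, forall x, Q x}.
Proof.
have aeF : Filter (almost_everywhere mu) by exact: ae_filter_ringOfSetsType.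
exact: filterS.
Qed.

Lemma aeS2 (P Q S : R -> Prop) : (forall x, P x -> Q x -> S x) ->
  {ae mu, forall x, P x} -> {ae mu, forall x, Q x} -> {ae mu, forall x, S x}.
Proof.
have aeF : Filter (almost_everywhere mu) by exact: ae_filter_ringOfSetsType.
exact: filterS2.
Qed.

Lemma integrable_itv f (i : interval R) :
  mu.-integrable setT (EFin \o f) -> mu.-integrable [set` i] (EFin \o f).
Proof. by move=> intf; apply: integrableS intf. Qed.

Lemma integrable_add (D : set R) f g : measurable D ->
  mu.-integrable D (EFin \o f) -> mu.-integrable D (EFin \o g) ->
  mu.-integrable D (EFin \o (fun x => f x + g x)).
Proof.
move=> mD intf intg.
have -> : EFin \o (fun x => f x + g x) = ((EFin \o f) \+ (EFin \o g))%E.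
  by apply/funext => x.
exact: integrableD.
Qed.

Lemma integrable_scale (D : set R) K f : measurable D ->
  mu.-integrable D (EFin \o f) -> mu.-integrable D (EFin \o (fun x => K * f x)).
Proof.
move=> mD intf.
have -> : EFin \o (fun x => K * f x) = (fun x => K%:E * (EFin \o f) x)%E.
  by apply/funext => x.
exact: integrableZl.
Qed.

Lemma Rintegral_split f c x y : c <= x -> x <= y ->
  mu.-integrable `[c, y] (EFin \o f) ->
  \int[mu]_(t in `[c, y]) f t - \int[mu]_(t in `[c, x]) f t =
  \int[mu]_(t in `[x, y]) f t.
Proof.
move=> cx xy intf; rewrite Rintegral_itvB ?bnd_simp//.
rewrite Rintegral_itv_obnd_cbnd//; apply: integrableS intf => //.
by apply: subset_itvr; rewrite bnd_simp.
Qed.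

Lemma small_integral f e : mu.-integrable setT (EFin \o f) ->
  (forall t, 0 <= f t) -> 0 < e ->
  exists2 d, 0 < d & forall A, measurable A -> (mu A < d%:E)%E ->
    \int[mu]_(t in A) f t < e.
Proof.
move=> intf f0 e0; have [d [d0 H]] := integral_normr_continuous intf e0.
exists d => // A mA Ad; apply: le_lt_trans (H A mA Ad).
by rewrite le_eqVlt; apply/orP; left; apply/eqP/eq_Rintegral => t _; rewrite ger0_norm.
Qed.

Lemma abs_continuous_unif c d f : abs_continuous c d f ->
  forall e, 0 < e -> exists2 r, 0 < r & forall x y, c <= x <= d -> c <= y <= d ->
    `|y - x| < r -> `|f y - f x| < e.
Proof.
move=> [g intg [g0 fg]] e e0; have [r r0 H] := small_integral intg g0 e0.
exists r => //.
suff W x y : c <= x -> x <= y -> y <= d -> `|y - x| < r -> `|f y - f x| < e.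
  move=> x y /andP[cx xd] /andP[cy yd] xy.
  have [le_xy|/ltW le_yx] := leP x y; first exact: W.
  by rewrite distrC; apply: W => //; rewrite distrC.
move=> cx xy yd xyr; apply: le_lt_trans (fg _ _ cx xy yd) _; apply: H => //.
rewrite lebesgue_measure_itv/= lte_fin; case: ifPn => _; last by rewrite lte_fin.
by rewrite -EFinD lte_fin -(ger0_norm (x := y - x))// subr_ge0.
Qed.

Lemma abs_continuous_bounded c d f : abs_continuous c d f ->
  exists2 K, 0 < K & forall x, c <= x <= d -> `|f x| <= K.
Proof.
move=> [g intg [g0 fg]].
exists (`|f c| + \int[mu]_(t in `[c, d]) g t + 1).
  by rewrite ltr_wpDl// addr_ge0//; apply: Rintegral_ge0.
move=> x /andP[cx xd]; have xc := fg _ _ (lexx c) cx xd.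
have H : \int[mu]_(t in `[c, x]) g t <= \int[mu]_(t in `[c, d]) g t.
  rewrite -subr_ge0 Rintegral_split//; first exact: Rintegral_ge0.
  exact: integrable_itv.
rewrite -[f x](subrK (f c)) (le_trans (ler_normD _ _))// [leLHS]addrC.
by rewrite -addrA lerD2l ler_wpDr// (le_trans xc).
Qed.

Lemma abs_continuous_at c d f : abs_continuous c d f ->
  forall x, c < x < d -> {for x, continuous f}.
Proof.
move=> acf x /andP[cx xd]; apply/cvgrPdist_lt => e e0.
have [r r0 H] := abs_continuous_unif acf e0.
near=> y; rewrite distrC; apply: H; first by rewrite !ltW.
  by apply/andP; split; apply: ltW; near: y; [exact: lt_nbhsr|exact: lt_nbhsl].
near: y; apply/nbhs_ballP; exists r => //= y; by rewrite /ball/= distrC.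
Unshelve. all: by end_near. Qed.

Lemma abs_continuousS c d c' d' f : c <= c' -> d' <= d ->
  abs_continuous c d f -> abs_continuous c' d' f.
Proof.
move=> cc dd [g intg [g0 fg]]; exists g => //; split=> // x y cx xy yd.
by apply: fg => //; [exact: le_trans cx|exact: le_trans dd].
Qed.

Lemma ac_deriveS c d c' d' f f' : c <= c' -> d' <= d ->
  ac_derive c d f f' -> ac_derive c' d' f f'.
Proof.
move=> cc dd [acf df]; split; first exact: abs_continuousS acf.
apply: aeS df => x df /andP[cx xd]; apply: df.
by rewrite (le_lt_trans cc)//= (lt_le_trans xd).
Qed.

Lemma abs_continuous_lip c d f K : 0 <= K ->
  (forall x y, c <= x -> x <= y -> y <= d -> `|f y - f x| <= K * (y - x)) ->
  abs_continuous c d f.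
Proof.
move=> K0 H; pose g : R -> R := cst K \_ `[c, d].
have g0 t : 0 <= g t by rewrite /g patchE; case: ifP.
have intg : mu.-integrable setT (EFin \o g).
  rewrite /g -restrict_EFin; apply/integrable_restrict => //.
  have cdoo : (mu `[c, d] < +oo)%E.
    by rewrite lebesgue_measure_itv/=; case: ifP => _; rewrite ?ltry.
  rewrite setTI; apply: measurable_bounded_integrable => //.
  exact: bounded_cst.
exists g => //; split=> // x y cx xy yd.
apply: le_trans (H _ _ cx xy yd) _.
rewrite le_eqVlt; apply/orP; left; apply/eqP.
rewrite (@eq_Rintegral _ _ _ _ _ (cst K)); last first.
  move=> t; rewrite inE/= in_itv/= => /andP[xt ty]; rewrite /g patchE ifT//.
  by rewrite inE/= in_itv/= (le_trans cx)// (le_trans ty).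
rewrite Rintegral_cst//= lebesgue_measure_itv/= lte_fin.
case: ltP => // yx; have -> : x = y by apply/eqP; rewrite eq_le xy yx.
by rewrite subrr.
Qed.

Lemma abs_continuousD c d f1 f2 : abs_continuous c d f1 -> abs_continuous c d f2 ->
  abs_continuous c d (fun x => f1 x + f2 x).
Proof.
move=> [g1 ig1 [g10 H1]] [g2 ig2 [g20 H2]].
exists (fun x => g1 x + g2 x).
  exact: integrable_add.
split=> [t|x y cx xy yd]; first by rewrite addr_ge0.
rewrite RintegralD; try exact: integrable_itv; try by [].
rewrite opprD addrACA (le_trans (ler_normD _ _))// lerD//; [exact: H1|exact: H2].
Qed.

Lemma abs_continuous_le c d f1 f2 K : 0 <= K -> abs_continuous c d f1 ->
  (forall x y, c <= x -> x <= y -> y <= d ->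
     `|f2 y - f2 x| <= K * `|f1 y - f1 x|) -> abs_continuous c d f2.
Proof.
move=> K0 [g ig [g0 H]] H2; exists (fun x => K * g x).
  exact: integrable_scale.
split=> [t|x y cx xy yd]; first by rewrite mulr_ge0.
rewrite RintegralZl//; last exact: integrable_itv.
by rewrite (le_trans (H2 _ _ cx xy yd))// ler_wpM2l// H.
Qed.

Lemma abs_continuousM c d f1 f2 : abs_continuous c d f1 -> abs_continuous c d f2 ->
  abs_continuous c d (fun x => f1 x * f2 x).
Proof.
move=> acf1 acf2; have [K1 K10 fK1] := abs_continuous_bounded acf1.
have [K2 K20 fK2] := abs_continuous_bounded acf2.
case: acf1 acf2 => [g1 ig1 [g10 H1]] [g2 ig2 [g20 H2]].
exists (fun x => K2 * g1 x + K1 * g2 x).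
  by apply: integrable_add => //; exact: integrable_scale.
split=> [t|x y cx xy yd]; first by rewrite addr_ge0// mulr_ge0// ltW.
rewrite RintegralD; try exact/integrable_itv/integrable_scale; try by [].
rewrite !RintegralZl; try exact: integrable_itv; try by [].
have -> : f1 y * f2 y - f1 x * f2 x =
  f2 y * (f1 y - f1 x) + f1 x * (f2 y - f2 x) by ring.
rewrite (le_trans (ler_normD _ _))// !normrM lerD// ler_pM//.
- by apply: fK2; rewrite yd andbT (le_trans cx).
- exact: H1.
- by apply: fK1; rewrite cx (le_trans xy).
- exact: H2.
Qed.

Lemma abs_continuousV c d f : abs_continuous c d f ->
  (exists2 m, 0 < m & forall x, c <= x <= d -> m <= `|f x|) ->
  abs_continuous c d (fun x => (f x)^-1).
Proof.
move=> acf [m m0 fm]; apply: (@abs_continuous_le _ _ f _ (m ^- 2)) => //.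
  by rewrite invr_ge0 sqr_ge0.
move=> x y cx xy yd.
have fx : m <= `|f x| by apply: fm; rewrite cx (le_trans xy).
have fy : m <= `|f y| by apply: fm; rewrite yd andbT (le_trans cx).
have fx0 : f x != 0 by rewrite -normr_gt0 (lt_le_trans m0).
have fy0 : f y != 0 by rewrite -normr_gt0 (lt_le_trans m0).
have -> : (f y)^-1 - (f x)^-1 = (f x * f y)^-1 * - (f y - f x).
  by field; rewrite fx0 fy0.
rewrite normrM normrN ler_wpM2r// normfV lef_pV2 ?posrE ?exprn_gt0//.
  by rewrite normrM expr2 ler_pM// ltW.
by rewrite normr_gt0 mulf_neq0.
Qed.

End AbsolutelyContinuous.

(** * Monotonicity from the sign of the derivative *)
Section Monotone.
Context {R : realType}.
Local Notation mu := (@lebesgue_measure R).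
Implicit Types (c d x y : R) (f g : R -> R).

Lemma is_derive_quotient f x l e : is_derive x 1 f l -> 0 < e ->
  exists2 r, 0 < r & forall y, x < y -> y < x + r -> f y - f x <= (l + e) * (y - x).
Proof.
move=> [df fl] e0.
have : h^-1 *: (f (h *: 1 + x) - f x) @[h --> 0^'] --> l by rewrite -fl; exact: df.
move=> /cvgrPdist_lt/(_ _ e0) [r /= r0 H].
exists r => // y xy yxr.
have yx0 : 0 < y - x by rewrite subr_gt0.
have := H (y - x); rewrite /ball_/= sub0r normrN gtr0_norm// ltrBlDl => /(_ yxr).
rewrite gt_eqF// => /(_ isT).
rewrite [_ *: 1]mulr1 subrK => /ltr_normlP[+ _].
rewrite opprB ltrBlDl => /ltW h; rewrite -ler_pdivrMr//.
by rewrite mulrC.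
Qed.

(** Cover the null set where nothing is known on the derivative by an open set
U on which the dominating function g has integral less than e.  Subtracting
from f the primitive of g restricted to U, and e x, gives a continuous F that
has, to the right of every point, a point where it is not larger: inside U the
subtracted primitive beats the increment of f, outside U the derivative does.
Hence F d <= F c, and e is arbitrary. *)
Lemma ac_derive_nonincreasing c d f f' : c <= d -> ac_derive c d f f' ->
  {ae mu, forall x, c < x < d -> f' x <= 0} -> f d <= f c.
Proof.
move=> cd [acf derf] f'0; have [g intg [g0 fg]] := acf.
have [A [mA A0 NA]] : {ae mu, forall x, c < x < d -> is_derive x 1 f (f' x) /\ f' x <= 0}.
  by apply: aeS2 derf f'0 => x h1 h2 xcd; split; [exact: h1|exact: h2].
apply/ler_addgt0Pr => e0 e00.
pose e := e0 / (1 + (d - c)).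
have dc1 : 0 < 1 + (d - c) by rewrite ltr_pwDl// subr_ge0.
have e_gt0 : 0 < e by rewrite divr_gt0.
have [r r0 Hr] := small_integral intg g0 e_gt0.
(* c is put into the null set because the derivative is known only inside. *)
pose D := A `|` [set c].
have mD : measurable D by exact: measurableU.
have muD : mu D = 0.
  apply/eqP; rewrite eq_le measure_ge0 andbT.
  by rewrite (le_trans (measureU2 _ _ _))//= A0 lebesgue_measure_set1 adde0.
have Doo : (mu D < +oo)%E by rewrite [X in (X < _)%E]muD.
have [U [oU DU UD]] := lebesgue_regularity_outer mD Doo r0.
have mU : measurable U by exact: measurable_realfun.open_measurable.
have muU : (mu U < r%:E)%E.
  apply: le_lt_trans UD.
  have : (mu ((U `\` D) `|` D) <= mu (U `\` D) + mu D)%E.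
    by apply: measureU2 => //; exact: measurableD.
  by rewrite setUC setDUK// [X in (_ <= _ + X)%E]muD adde0.
pose h := g \_ U.
have h0 t : 0 <= h t by rewrite /h patchE; case: ifP.
have inth : mu.-integrable setT (EFin \o h).
  rewrite /h -restrict_EFin; apply/integrable_restrict => //.
  by rewrite setTI; apply: integrableS intg.
pose H x := \int[mu]_(t in `[c, x]) h t.
have HB x y : c <= x -> x <= y -> H y - H x = \int[mu]_(t in `[x, y]) h t.
  by move=> cx xy; rewrite Rintegral_split//; exact: integrable_itv.
have acH : abs_continuous c d H.
  exists h => //; split=> // x y cx xy yd; rewrite HB// ger0_norm//.
  exact: Rintegral_ge0.
pose F x := f x + (- 1 * H x + - e * x).
have acF : abs_continuous c d F.
  apply: abs_continuousD => //; apply: abs_continuousD.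
    apply: (abs_continuous_le (K := 1) _ acH) => // x y _ _ _.
    by rewrite -mulrBr normrM normrN normr1.
  apply: (@abs_continuous_lip _ _ _ _ e); first exact: ltW.
  move=> x y _ xy _; rewrite -mulrBr normrM normrN (gtr0_norm e_gt0).
  by rewrite ger0_norm// subr_ge0.
have FB x y : F y - F x = (f y - f x) - (H y - H x) - e * (y - x).
  by rewrite /F; ring.
have step x : c <= x -> x < d -> exists2 y, x < y <= d & F y <= F x.
  move=> cx xd; have [Ux|nUx] := pselect (U x).
    have /nbhs_ballP[s /= s0 sU] : nbhs x U by exact: open_nbhs_nbhs.
    pose y := Num.min d (x + s / 2).
    have xy : x < y by rewrite /y lt_min xd/= ltrDl divr_gt0.
    have ys : y <= x + s / 2 by rewrite /y ge_min lexx orbT.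
    have yd : y <= d by rewrite /y ge_min lexx.
    exists y; first by rewrite xy.
    rewrite -subr_le0 FB HB//; last exact: ltW.
    rewrite subr_le0 (@le_trans _ _ 0)//; last first.
      by rewrite mulr_ge0// ?subr_ge0 ltW.
    rewrite subr_le0 (le_trans (ler_norm _))// (le_trans (fg _ _ cx (ltW xy) yd))//.
    rewrite le_eqVlt; apply/orP; left; apply/eqP/eq_Rintegral => t.
    rewrite inE/= in_itv/= => /andP[xt ty]; rewrite /h patchE ifT// inE.
    apply: sU; rewrite /ball/= distrC ger0_norm ?subr_ge0// ltrBlDl.
    rewrite (le_lt_trans ty)// (le_lt_trans ys)// ltrD2l.
    by rewrite ltr_pdivrMr// ltr_pMr// ltr1n.
  have {}cx : c < x.
    rewrite lt_neqAle cx andbT; apply/negP => /eqP cx'; apply: nUx; apply: DU.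
    by right; rewrite /= cx'.
  have [dfx f'x] : is_derive x 1 f (f' x) /\ f' x <= 0.
    apply: contrapT => nH; apply: nUx; apply: DU; left; apply: NA => /= K.
    by apply: nH; apply: K; rewrite cx.
  have [s s0 Hs] := is_derive_quotient dfx e_gt0.
  pose y := Num.min d (x + s / 2).
  have xy : x < y by rewrite /y lt_min xd/= ltrDl divr_gt0.
  have ys : y <= x + s / 2 by rewrite /y ge_min lexx orbT.
  have yd : y <= d by rewrite /y ge_min lexx.
  exists y; first by rewrite xy.
  rewrite -subr_le0 FB subr_le0; apply: (@le_trans _ _ (f y - f x)).
    rewrite lerBlDr lerDl HB//; first exact: Rintegral_ge0.
    exact: ltW.
    exact: ltW.
  apply: le_trans (Hs y xy _) _.
    by rewrite (le_lt_trans ys)// ltrD2l ltr_pdivrMr// ltr_pMr// ltr1n.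
  by rewrite ler_wpM2r ?subr_ge0// ?(ltW xy)// gerDr.
have Fdc : F d <= F c.
  (* The supremum of the points where F <= F c belongs to them by continuity;
     by [step] it cannot be smaller than d. *)
  pose T := [set x | c <= x <= d /\ F x <= F c].
  have Tc : T c by split; rewrite ?lexx.
  have supT : has_sup T by split; [exists c|exists d => x [/andP[]]].
  pose m := sup T.
  have cm : c <= m by apply: sup_ubound => //; case: supT.
  have md : m <= d by apply: ge_sup => //; [exists c|move=> x [/andP[]]].
  have Fm : F m <= F c.
    rewrite leNgt; apply/negP => Fcm; have Fm0 : 0 < F m - F c by rewrite subr_gt0.
    have [s s0 Hs] := abs_continuous_unif acF Fm0.
    have [x [/andP[cx xd] Fx] mx] := sup_adherent s0 supT.
    have xm : x <= m.
      by apply: sup_ubound; [case: supT|split=> //; rewrite cx].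
    have := Hs x m; rewrite cx xd cm md => /(_ isT isT).
    rewrite ger0_norm ?subr_ge0// ltrBlDl -ltrBlDr => /(_ mx).
    by move=> /ltr_normlP[_]; rewrite ltrD2l ltrN2; move: Fx; case: ltgtP.
  have [dm|md'] := leP d m.
    by have <- : m = d by apply/eqP; rewrite eq_le md dm.
  have [y /andP[my yd] Fy] := step m cm md'.
  have : y <= m.
    apply: sup_ubound => //; first by case: supT.
    by split; [rewrite yd (le_trans cm)// ltW|exact: le_trans Fy Fm].
  by rewrite leNgt my.
have := Fdc; rewrite -subr_le0 FB HB// => Hd.
have He : \int[mu]_(t in `[c, d]) h t <= e.
  rewrite ltW//; apply: (le_lt_trans _ (Hr U mU muU)).
  rewrite /h -Rintegral_mkcondr; rewrite /Rintegral fine_le//.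
  - apply: integrable_fin_num => //; first exact: measurableI.
    by apply: integrableS intg => //; exact: measurableI.
  - by apply: integrable_fin_num => //; apply: integrableS intg.
  - apply: ge0_subset_integral => //; first exact: measurableI.
    - by apply: (measurable_int mu); apply: integrableS intg.
    - by move=> t _; rewrite lee_fin.
have : e * (1 + (d - c)) = e0 by rewrite /e mulfVK// gt_eqF.
move: Hd He; lra.
Qed.

End Monotone.

(** * Calculus of almost everywhere derivatives *)

Lemma itv_oo_cc {R : realType} (c x d : R) : c < x < d -> c <= x <= d.
Proof. by move=> /andP[cx xd]; rewrite !ltW. Qed.

Section Calculus.
Context {R : realType}.
Local Notation mu := (@lebesgue_measure R).
Implicit Types (c d x y : R) (f g : R -> R).

Lemma ac_derive_ae c d f f1 f2 : ac_derive c d f f1 ->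
  {ae mu, forall x, c < x < d -> f1 x = f2 x} -> ac_derive c d f f2.
Proof.
move=> [acf df] H; split=> //; apply: aeS2 df H => x h1 h2 xcd.
by rewrite -h2//; exact: h1.
Qed.

Lemma ac_deriveN c d f f' : ac_derive c d f f' ->
  ac_derive c d (fun x => - f x) (fun x => - f' x).
Proof.
move=> [acf df]; split.
  apply: (abs_continuous_le (K := 1) _ acf) => // x y _ _ _.
  by rewrite mul1r -opprD normrN.
by apply: aeS df => x h /h {}h; exact: is_deriveN.
Qed.

Lemma ac_derive_nondecreasing c d f f' : c <= d -> ac_derive c d f f' ->
  {ae mu, forall x, c < x < d -> 0 <= f' x} -> f c <= f d.
Proof.
move=> cd /ac_deriveN acf f0; rewrite -lerN2.
apply: (ac_derive_nonincreasing cd acf).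
by apply: aeS f0 => x h /h; rewrite oppr_le0.
Qed.

Lemma ac_derive_const c d f f' : c <= d -> ac_derive c d f f' ->
  {ae mu, forall x, c < x < d -> f' x = 0} -> f d = f c.
Proof.
move=> cd acf f0; apply/eqP; rewrite eq_le; apply/andP; split.
  by apply: (ac_derive_nonincreasing cd acf); apply: aeS f0 => x h /h ->.
by apply: (ac_derive_nondecreasing cd acf); apply: aeS f0 => x h /h ->.
Qed.

Lemma ac_deriveD c d f f' g g' : ac_derive c d f f' -> ac_derive c d g g' ->
  ac_derive c d (fun x => f x + g x) (fun x => f' x + g' x).
Proof.
move=> [acf df] [acg dg]; split; first exact: abs_continuousD.
by apply: aeS2 df dg => x h1 h2 xcd; apply: is_deriveD; [exact: h1|exact: h2].
Qed.

Lemma ac_deriveB c d f f' g g' : ac_derive c d f f' -> ac_derive c d g g' ->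
  ac_derive c d (fun x => f x - g x) (fun x => f' x - g' x).
Proof. by move=> hf /ac_deriveN; exact: ac_deriveD. Qed.

Lemma ac_derive_cst c d k : ac_derive c d (cst k) (cst 0).
Proof.
split; last by apply: aeW => x _; exact: is_derive_cst.
by apply: (@abs_continuous_lip _ _ _ _ 0) => // x y _ _ _; rewrite subrr normr0 mul0r.
Qed.

Lemma ac_deriveM c d f f' g g' : ac_derive c d f f' -> ac_derive c d g g' ->
  ac_derive c d (fun x => f x * g x) (fun x => f' x * g x + f x * g' x).
Proof.
move=> [acf df] [acg dg]; split; first exact: abs_continuousM.
apply: aeS2 df dg => x h1 h2 xcd.
apply: is_derive_eq (is_deriveM (h1 xcd) (h2 xcd)) _.
by rewrite addrC /GRing.scale/= [g x * _]mulrC.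
Qed.

Lemma ac_deriveZ c d k f f' : ac_derive c d f f' ->
  ac_derive c d (fun x => k * f x) (fun x => k * f' x).
Proof.
move=> acf; apply: ac_derive_ae (ac_deriveM (ac_derive_cst c d k) acf) _.
by apply: aeW => x _; rewrite /cst mul0r add0r.
Qed.

Lemma abs_continuous_away0 c d f : c <= d -> abs_continuous c d f ->
  (forall x, c <= x <= d -> f x != 0) ->
  exists2 m, 0 < m & forall x, c <= x <= d -> m <= `|f x|.
Proof.
move=> cd acf f0.
have : {within `[c, d], continuous (fun x => `|f x|)}.
  apply/subspace_continuousP => x /=; rewrite in_itv/= => xcd.
  apply/cvgrPdist_lt => e e0; have [r r0 H] := abs_continuous_unif acf e0.
  apply/nbhs_ballP; exists r => //= y; rewrite /ball/= distrC => xyr.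
  rewrite in_itv/= => ycd.
  by rewrite distrC (le_lt_trans (ler_dist_dist _ _))//; exact: H.
move=> /(EVT_min cd)[z]; rewrite in_itv/= => zcd Hz.
exists `|f z|; first by rewrite normr_gt0 f0.
by move=> x xcd; apply: Hz; rewrite in_itv.
Qed.

Lemma ac_deriveV c d f f' : c <= d -> ac_derive c d f f' ->
  (forall x, c <= x <= d -> f x != 0) ->
  ac_derive c d (fun x => (f x)^-1) (fun x => - f' x / f x ^+ 2).
Proof.
move=> cd [acf df] f0; split.
  exact: (abs_continuousV acf (abs_continuous_away0 cd acf f0)).
apply: aeS df => x h xcd.
have fx0 : f x != 0 by apply: f0; case/andP: xcd => cx xd; rewrite !ltW.
apply: is_derive_eq (is_deriveV fx0 (h xcd)) _.
by rewrite /GRing.scale/= mulrC mulrN mulNr.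
Qed.

(** By the mean value theorem F is Lipschitz on [l, u], which contains the
values of f; the increments of F o f are then dominated by those of f. *)
Lemma ac_derive_comp c d f f' (l u K : R) (F F' : R -> R) :
  ac_derive c d f f' -> (forall x, c <= x <= d -> l <= f x <= u) ->
  (forall t, l <= t <= u -> is_derive t 1 F (F' t)) ->
  (forall t, l <= t <= u -> `|F' t| <= K) ->
  ac_derive c d (fun x => F (f x)) (fun x => F' (f x) * f' x).
Proof.
move=> [acf df] flu dF FK.
have lipF x y : l <= x -> x <= y -> y <= u -> `|F y - F x| <= K * `|y - x|.
  move=> lx xy yu.
  have dFxy t : x <= t <= y -> is_derive t 1 F (F' t).
    by move=> /andP[xt ty]; apply: dF; rewrite (le_trans lx)// (le_trans ty).
  have [||z] := @MVT_segment _ F F' x y xy.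
  - by move=> t; rewrite in_itv/= => /andP[/ltW xt /ltW ty]; apply: dFxy; rewrite xt.
  - apply: derivable_within_continuous => t; rewrite in_itv/= => txy.
    by have [] := dFxy t txy.
  rewrite in_itv/= => /andP[xz zy] ->; rewrite normrM ler_wpM2r// FK//.
  by rewrite (le_trans lx)// (le_trans zy).
split.
  have [x0|] := leP 0 K; last first.
    move=> K0; apply: (@abs_continuous_lip _ _ _ _ 0) => // x y cx xy yd.
    have /flu/FK : c <= x <= d by rewrite cx (le_trans xy).
    by move=> /(le_trans (normr_ge0 _)); rewrite leNgt K0.
  apply: (abs_continuous_le (K := K) _ acf) => // x y cx xy yd.
  have /flu/andP[lx xu] : c <= x <= d by rewrite cx (le_trans xy).
  have /flu/andP[ly yu] : c <= y <= d by rewrite yd (le_trans cx).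
  have [fxy|/ltW fyx] := leP (f x) (f y); first exact: lipF.
  by rewrite distrC [X in _ * X]distrC lipF.
apply: aeS df => x h xcd; apply: is_derive1_comp; last exact: h.
by apply/dF/flu; case/andP: xcd => cx xd; rewrite !ltW.
Qed.

Lemma ac_derive_ln c d f f' : c <= d -> ac_derive c d f f' ->
  (forall x, c <= x <= d -> 0 < f x) ->
  ac_derive c d (fun x => ln (f x)) (fun x => f' x / f x).
Proof.
move=> cd acf f0.
have [m m0 fm] : exists2 m, 0 < m & forall x, c <= x <= d -> m <= `|f x|.
  by apply: abs_continuous_away0 => // [|x /f0/lt0r_neq0//]; case: acf.
have [M M0 fM] := abs_continuous_bounded acf.1.
have /ac_derive_ae : ac_derive c d (fun x => ln (f x)) (fun x => (f x)^-1 * f' x).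
  apply: (@ac_derive_comp _ _ f f' m M (m^-1) (@ln R) (fun t => t^-1)) => //.
  - by move=> x xcd; rewrite -(gtr0_norm (f0 x xcd)) fm//= fM.
  - by move=> t /andP[mt _]; apply: is_derive1_ln; exact: lt_le_trans mt.
  - move=> t /andP[mt _]; have t0 := lt_le_trans m0 mt.
    by rewrite gtr0_norm ?invr_gt0// lef_pV2.
by apply; apply: aeW => x _; rewrite mulrC.
Qed.

Lemma ac_derive_atan c d f f' : ac_derive c d f f' ->
  ac_derive c d (fun x => atan (f x)) (fun x => f' x / (1 + f x ^+ 2)).
Proof.
move=> acf; have [M M0 fM] := abs_continuous_bounded acf.1.
have /ac_derive_ae : ac_derive c d (fun x => atan (f x)) (fun x => (1 + f x ^+ 2)^-1 * f' x).
  apply: (@ac_derive_comp _ _ f f' (- M) M 1 (@atan R) (fun t => (1 + t ^+ 2)^-1)) => //.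
  - by move=> x /fM; rewrite ler_norml.
  - move=> t _; have t2 : 0 < 1 + t ^+ 2 by rewrite ltr_pwDl// sqr_ge0.
    by rewrite gtr0_norm ?invr_gt0// invf_le1// lerDl sqr_ge0.
by apply; apply: aeW => x _; rewrite mulrC.
Qed.

(** The Lebesgue differentiation theorem, through FTC1 for g cut off outside
[c, d]. *)
Lemma ac_derive_increment c d f g : mu.-integrable `[c, d] (EFin \o g) ->
  (forall x y, c <= x -> x <= y -> y <= d ->
     f y - f x = \int[mu]_(t in `[x, y]) g t) -> ac_derive c d f g.
Proof.
move=> intg fg; pose G := g \_ `[c, d].
have intG : mu.-integrable setT (EFin \o G).
  by rewrite /G -restrict_EFin; apply/integrable_restrict => //; rewrite setTI.
have GE x y : c <= x -> y <= d -> \int[mu]_(t in `[x, y]) G t = \int[mu]_(t in `[x, y]) g t.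
  move=> cx yd; apply: eq_Rintegral => t; rewrite inE/= in_itv/= => /andP[xt ty].
  by rewrite /G patchE ifT// inE/= in_itv/= (le_trans cx)// (le_trans ty).
split.
  exists (fun t => `|G t|).
    have -> : EFin \o (fun t => `|G t|) = (abse \o (EFin \o G)) by [].
    exact: integrable_abse.
  split=> // x y cx xy yd; rewrite fg// -GE//.
  by apply: le_normr_Rintegral => //; exact: integrable_itv.
have locG : locally_integrable [set: R] G by exact: integrable_locally.
have := @FTC1 R G (BLeft c) (fun y => integrable_itv _ intG) locG.
apply: aeS => x /= + /andP[cx xd] => /(_ _)[|dF F'].
  by rewrite lte_fin.
rewrite [RHS]patchE ifT in F'; last by rewrite inE/= in_itv/= !ltW.
apply: (@near_eq_is_derive _ _ _
   (fun x => f c + \int[mu]_(t in `[c, x]) G t)); last first.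
  rewrite -[g x]add0r; apply: (is_deriveD (is_derive_cst (f c) x 1)).
  by split=> //; rewrite -derive1E.
near=> y; have /andP[cy yd] : c < y < d.
  by apply/andP; split; near: y; [exact: lt_nbhsr|exact: lt_nbhsl].
by rewrite GE ?(ltW yd)// -(fg c y) ?(ltW cy) ?(ltW yd)// addrC subrK.
Unshelve. all: by end_near. Qed.

End Calculus.

(** * Primitives *)
Section Primitive.
Context {R : realType}.
Local Notation mu := (@lebesgue_measure R).
Implicit Types (a c d x y : R) (f g : R -> R).

Lemma integrable_oo_cc c d g : mu.-integrable `]c, d[ (EFin \o g) ->
  mu.-integrable `[c, d] (EFin \o g).
Proof.
move=> /integrableP[mg ig]; apply/integrableP; split.
  exact: emeasurable_fun_itv_cc mg.
have mg' : measurable_fun `]c, d[ (fun x => `|g x|).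
  by apply: measurableT_comp => //; apply/measurable_EFinP.
have -> : (\int[mu]_(x in `[c, d]) `|(EFin \o g) x| =
    \int[mu]_(x in `[c, d]) (`|g x|)%:E)%E by [].
rewrite -integral_itv_bndo_bndc; last first.
  by apply/measurable_EFinP; exact: measurable_fun_itv_co mg'.
by rewrite -integral_itv_obnd_cbnd//; exact/measurable_EFinP.
Qed.

Lemma Rintegral_oo_cc c d g : mu.-integrable `]c, d[ (EFin \o g) ->
  \int[mu]_(t in `]c, d[) g t = \int[mu]_(t in `[c, d]) g t.
Proof.
move=> ig; rewrite -Rintegral_itv_bndo_bndc ?Rintegral_itv_obnd_cbnd//.
apply: integrableS (integrable_oo_cc ig) => //.
by apply: subset_itvl; rewrite bnd_simp.
Qed.

Lemma integrable_sub c d c' d' g : c <= c' -> d' <= d ->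
  mu.-integrable `]c, d[ (EFin \o g) -> mu.-integrable `]c', d'[ (EFin \o g).
Proof.
move=> cc dd; apply: integrableS => // x /=; rewrite !in_itv/= => /andP[cx xd].
by rewrite (le_lt_trans cc)//= (lt_le_trans xd).
Qed.

Lemma primitive_increment a d g x y : mu.-integrable `]a, d[ (EFin \o g) ->
  a <= x -> x <= y -> y <= d ->
  \int[mu]_(t in `]a, y[) g t - \int[mu]_(t in `]a, x[) g t =
  \int[mu]_(t in `[x, y]) g t.
Proof.
move=> ig ax xy yd.
have iy : mu.-integrable `]a, y[ (EFin \o g) by exact: integrable_sub ig.
have ix : mu.-integrable `]a, x[ (EFin \o g).
  by apply: integrable_sub ig => //; exact: le_trans yd.
by rewrite !Rintegral_oo_cc// Rintegral_split//; exact: integrable_oo_cc.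
Qed.

Lemma primitive_ac_derive a d g : mu.-integrable `]a, d[ (EFin \o g) ->
  ac_derive a d (fun x => \int[mu]_(t in `]a, x[) g t) g.
Proof.
move=> ig; apply: ac_derive_increment; first exact: integrable_oo_cc.
by move=> x y ax xy yd; exact: primitive_increment ig ax xy yd.
Qed.

Lemma abs_continuous_measurable c d f : abs_continuous c d f ->
  measurable_fun `[c, d] f.
Proof.
move=> acf; apply: subspace_continuous_measurable_fun => //.
apply/subspace_continuousP => x /=; rewrite in_itv/= => xcd.
apply/cvgrPdist_lt => e e0; have [r r0 H] := abs_continuous_unif acf e0.
apply/nbhs_ballP; exists r => //= y; rewrite /ball/= distrC => xyr.
by rewrite in_itv/= => ycd; rewrite distrC; exact: H.
Qed.

Lemma integrable_mul_bounded (D : set R) g f K : measurable D ->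
  measurable_fun D f -> (forall x, D x -> `|f x| <= K) ->
  mu.-integrable D (EFin \o g) -> mu.-integrable D (EFin \o (fun x => g x * f x)).
Proof.
move=> mD mf fK ig.
have -> : EFin \o (fun x => g x * f x) = ((EFin \o g) \* (EFin \o f))%E.
  by apply/funext => x; rewrite /= EFinM.
apply: integrableMl => //; exists K; split; first exact: num_real.
by move=> M KM x Dx /=; rewrite (le_trans (fK x Dx))// ltW.
Qed.

Lemma integrable_mul_ac c d g f : abs_continuous c d f ->
  mu.-integrable `]c, d[ (EFin \o g) ->
  mu.-integrable `]c, d[ (EFin \o (fun x => g x * f x)).
Proof.
move=> acf ig; have [K K0 fK] := abs_continuous_bounded acf.
apply: (integrable_mul_bounded (K := K)) => //.
  apply: measurable_funS (abs_continuous_measurable acf) => //.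
  exact: subset_itv_oo_cc.
by move=> x /=; rewrite in_itv/= => /andP[/ltW cx /ltW xd]; rewrite fK// cx.
Qed.

(** Dominated convergence with dominating function C |g|. *)
Lemma cvg_integral_bounded_factor c d g (s : nat -> R -> R) (l : R -> R) C :
  mu.-integrable `]c, d[ (EFin \o g) ->
  (forall n, measurable_fun `]c, d[ (s n)) ->
  (forall x, c < x < d -> s ^~ x @ \oo --> l x) ->
  (forall n x, c < x < d -> `|s n x| <= C) ->
  mu.-integrable `]c, d[ (EFin \o (fun x => g x * l x)) /\
  (fun n => \int[mu]_(t in `]c, d[) (g t * s n t)) @ \oo -->
    \int[mu]_(t in `]c, d[) (g t * l t).
Proof.
move=> ig ms sl sC.
have mg : measurable_fun `]c, d[ g by apply/measurable_EFinP; case/integrableP : ig.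
have ml : measurable_fun `]c, d[ l.
  by apply: (measurable_fun_cvg (h := s)) => // x /=; rewrite in_itv/=; exact: sl.
have iG : mu.-integrable `]c, d[ (EFin \o (fun x => C * `|g x|)).
  by apply: integrable_scale => //; move: (integrable_abse ig).
have [||||| h1 h2 h3] := @dominated_convergence _ _ R mu `]c, d[ (measurable_itv _)
  (fun n x => (g x * s n x)%:E) (fun x => (g x * l x)%:E) (EFin \o (fun x => C * `|g x|)).
- by move=> n; apply/measurable_EFinP; exact: (measurable_funM mg (ms n)).
- by apply/measurable_EFinP; exact: (measurable_funM mg ml).
- apply: aeW => x /=; rewrite in_itv/= => /sl xl.
  apply: cvg_EFin; first exact: nearW.
  by apply: cvgMr.
- exact: iG.
- apply: aeW => x n /=; rewrite in_itv/= => /(sC n) h.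
  by rewrite lee_fin normrM mulrC ler_wpM2r.
split=> //; apply: (@fine_cvg _ _ \oo).
by rewrite fineK//; exact: integrable_fin_num.
Qed.

End Primitive.

(** * Linear systems with integrable coefficients *)
Section LinearSystem.
Context {R : realType}.
Local Notation mu := (@lebesgue_measure R).
Variables (a : R) (P V : R -> R) (al be : R).

(** The terms, rather than the partial sums, of the Picard series of
u' = P w, w' = V u with (u, w)(a) = (al, be). *)
Fixpoint picard (k : nat) : (R -> R) * (R -> R) :=
  if k is k'.+1 then
    (fun x => \int[mu]_(t in `]a, x[) (P t * (picard k').2 t),
     fun x => \int[mu]_(t in `]a, x[) (V t * (picard k').1 t))
  else (cst al, cst be).

Let m t := `|P t| + `|V t|.
Let M x := \int[mu]_(t in `]a, x[) m t.
Let K := `|al| + `|be|.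

Let u x := limn (series (fun k => (picard k).1 x)).
Let w x := limn (series (fun k => (picard k).2 x)).

Section Bounded.
Variable d : R.
Hypothesis ad : a < d.
Hypothesis iP : mu.-integrable `]a, d[ (EFin \o P).
Hypothesis iV : mu.-integrable `]a, d[ (EFin \o V).

Let im : mu.-integrable `]a, d[ (EFin \o m).
Proof.
by apply: integrable_add => //; [move: (integrable_abse iP)|move: (integrable_abse iV)].
Qed.

Let acM : ac_derive a d M m.
Proof. exact: primitive_ac_derive. Qed.

Let Ma : M a = 0.
Proof. by rewrite /M set_itvoo0 Rintegral_set0. Qed.

Let M0 x : a <= x <= d -> 0 <= M x.
Proof.
by move=> _; apply: Rintegral_ge0 => t _; rewrite addr_ge0.
Qed.

(** With m = |P| + |V| and M its primitive, the primitive of m (M^k / k!) is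
M^(k+1) / (k+1)!, so B k dominates the k-th Picard term and the Picard series
is dominated by an exponential series. *)
Let B k x : R := K * (k`!%:R^-1 * M x ^+ k).

Let acB k : ac_derive a d (B k.+1) (fun x => m x * B k x).
Proof.
have H : ac_derive a d (fun x => M x ^+ k.+1) (fun x => m x * (k.+1%:R * M x ^+ k)).
  elim: k => [|k IH].
    rewrite (_ : (fun x => M x ^+ 1) = M); last by apply/funext => x; rewrite expr1.
    by apply: ac_derive_ae acM _; apply: aeW => x _; rewrite expr0 !mulr1.
  rewrite (_ : (fun x => _) = (fun x => M x * M x ^+ k.+1)); last first.
    by apply/funext => x; rewrite -exprS.
  apply: ac_derive_ae (ac_deriveM acM IH) _; apply: aeW => x _.
  by rewrite [k.+2%:R]mulrS exprS; ring.
apply: ac_derive_ae (ac_deriveZ K (ac_deriveZ (k.+1`!%:R^-1) H)) _.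
apply: aeW => x _; rewrite /B factS natrM.
have k0 : (k.+1%:R : R) != 0 by rewrite pnatr_eq0.
have f0 : (k`!%:R : R) != 0 by rewrite pnatr_eq0 -lt0n fact_gt0.
by field; rewrite f0 addrC -natr1 in k0 *.
Qed.

Let dominated_primitive k f g : ac_derive a d f (fun x => g x) -> f a = 0 ->
  (forall x, a < x < d -> `|g x| <= m x * B k x) ->
  forall x, a <= x <= d -> `|f x| <= B k.+1 x.
Proof.
move=> acf fa0 gB x /andP[ax xd].
have Ba : B k.+1 a = 0 by rewrite /B Ma expr0n !mulr0.
have acf' := ac_deriveS (lexx a) xd acf.
have acB' := ac_deriveS (lexx a) xd (acB k).
rewrite ler_norml; apply/andP; split.
  rewrite -subr_ge0 opprK -[X in X <= _](_ : f a + B k.+1 a = 0); last first.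
    by rewrite Ba fa0 addr0.
  apply: (ac_derive_nondecreasing ax (ac_deriveD acf' acB')).
  apply: aeW => t /andP[at_ tx].
  have /gB/ler_normlP[h _] : a < t < d by rewrite at_ (lt_le_trans tx).
  by rewrite -lerBlDl sub0r.
rewrite -subr_ge0 -[X in X <= _](_ : B k.+1 a - f a = 0); last first.
  by rewrite Ba fa0 subr0.
apply: (ac_derive_nondecreasing ax (ac_deriveB acB' acf')).
apply: aeW => t /andP[at_ tx].
have /gB/ler_normlP[_ h] : a < t < d by rewrite at_ (lt_le_trans tx).
by rewrite subr_ge0.
Qed.

Let picardP k :
  [/\ abs_continuous a d (picard k).1, abs_continuous a d (picard k).2,
   forall x, a <= x <= d -> `|(picard k).1 x| <= B k x &
   forall x, a <= x <= d -> `|(picard k).2 x| <= B k x].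
Proof.
elim: k => [|k [ac1 ac2 b1 b2]].
  rewrite /B fact0 invr1 /=; split.
  - by case: (ac_derive_cst a d al).
  - by case: (ac_derive_cst a d be).
  - by move=> x _; rewrite expr0 !mulr1 lerDl.
  - by move=> x _; rewrite expr0 !mulr1 lerDr.
have h1 := primitive_ac_derive (integrable_mul_ac ac2 iP).
have h2 := primitive_ac_derive (integrable_mul_ac ac1 iV).
split; [by case: h1|by case: h2| |].
  apply: (dominated_primitive h1); first by rewrite set_itvoo0 Rintegral_set0.
  move=> x /andP[ax xd]; rewrite normrM ler_pM//; first by rewrite lerDl.
  by apply: b2; rewrite !ltW.
apply: (dominated_primitive h2); first by rewrite set_itvoo0 Rintegral_set0.
move=> x /andP[ax xd]; rewrite normrM ler_pM//; first by rewrite lerDr.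
by apply: b1; rewrite !ltW.
Qed.

Let S1 n x := series (fun k => (picard k).1 x) n.
Let S2 n x := series (fun k => (picard k).2 x) n.

Let seriesB n x : series (fun k => B k x) n = K * series (exp_coeff (M x)) n.
Proof.
rewrite /series/= mulr_sumr; apply: eq_bigr => k _.
by rewrite /B /exp_coeff/= [_^-1 * _]mulrC.
Qed.

Let seriesB_le n x : a <= x <= d -> series (fun k => B k x) n <= K * expR (M x).
Proof.
move=> xad; rewrite seriesB ler_wpM2l ?addr_ge0//.
apply: nondecreasing_cvgn_le; last exact: is_cvg_series_exp_coeff.
apply: nondecreasing_series => k _ _.
by rewrite /exp_coeff/= divr_ge0 ?exprn_ge0 ?M0.
Qed.

Let cvg_dominated (s : nat -> R) x : a <= x <= d -> (forall k, `|s k| <= B k x) ->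
  cvgn (series s).
Proof.
move=> xad sB; apply: normed_cvg.
apply: (@series_le_cvg _ _ (fun k => B k x)) => //.
- by move=> k; rewrite normr_ge0.
- by move=> k; apply: le_trans (sB k).
rewrite (_ : series _ = (fun n => K * series (exp_coeff (M x)) n)); last first.
  by apply/funext => n; exact: seriesB.
by apply: is_cvgMr; exact: is_cvg_series_exp_coeff.
Qed.

Let S1_cvg x : a <= x <= d -> S1 ^~ x @ \oo --> u x.
Proof.
by move=> xad; apply: (cvg_dominated xad) => k; have [_ _ b1 _] := picardP k; exact: b1.
Qed.

Let S2_cvg x : a <= x <= d -> S2 ^~ x @ \oo --> w x.
Proof.
by move=> xad; apply: (cvg_dominated xad) => k; have [_ _ _ b2] := picardP k; exact: b2.
Qed.

Let series_bound (s : nat -> R) n x : a <= x <= d -> (forall k, `|s k| <= B k x) ->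
  `|series s n| <= K * expR (M x).
Proof.
move=> xad sB; apply: le_trans (seriesB_le n xad).
by rewrite /series/= (le_trans (ler_norm_sum _ _ _))// ler_sum.
Qed.

Let S_bounded : exists C, forall n x, a < x < d -> `|S1 n x| <= C /\ `|S2 n x| <= C.
Proof.
have [C C0 MC] := abs_continuous_bounded acM.1.
exists (K * expR C) => n x /andP[ax xd].
have xad : a <= x <= d by rewrite !ltW.
have H : K * expR (M x) <= K * expR C.
  rewrite ler_wpM2l ?addr_ge0// ler_expR (le_trans (ler_norm _))//; exact: MC.
split; apply: le_trans H; apply: series_bound => // k.
  by have [_ _ b1 _] := picardP k; exact: b1.
by have [_ _ _ b2] := picardP k; exact: b2.
Qed.

Let S_ac n : abs_continuous a d (S1 n) /\ abs_continuous a d (S2 n).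
Proof.
elim: n => [|n [IH1 IH2]].
  have -> : S1 0 = cst 0 by apply/funext => x; rewrite /S1 /series/= big_geq.
  have -> : S2 0 = cst 0 by apply/funext => x; rewrite /S2 /series/= big_geq.
  by case: (ac_derive_cst a d 0).
have [ac1 ac2 _ _] := picardP n; split.
  rewrite (_ : S1 _ = (fun x => S1 n x + (picard n).1 x)); first exact: abs_continuousD.
  by apply/funext => x; rewrite /S1 seriesSr.
rewrite (_ : S2 _ = (fun x => S2 n x + (picard n).2 x)); first exact: abs_continuousD.
by apply/funext => x; rewrite /S2 seriesSr.
Qed.

Let S_step n : S1 n.+1 d = al + \int[mu]_(t in `]a, d[) (P t * S2 n t) /\
  S2 n.+1 d = be + \int[mu]_(t in `]a, d[) (V t * S1 n t).
Proof.
elim: n => [|n [IH1 IH2]].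
  rewrite /S1 /S2 /series/= !big_nat1/= !(@eq_Rintegral _ _ _ _ _ (cst 0)).
  - by rewrite !Rintegral_cst// !mul0r !addr0.
  - by move=> t _; rewrite big_geq// mulr0.
  - by move=> t _; rewrite big_geq// mulr0.
have [ac1 ac2 _ _] := picardP n; have [sc1 sc2] := S_ac n.
split.
  rewrite [S1 _ _]seriesSr -/(S1 n.+1 d) IH1 -addrA; congr (_ + _)%R.
  rewrite -RintegralD//; try exact: integrable_mul_ac.
  by apply: eq_Rintegral => t _; rewrite -mulrDr /S2 seriesSr.
rewrite [S2 _ _]seriesSr -/(S2 n.+1 d) IH2 -addrA; congr (_ + _).
rewrite -RintegralD//; try exact: integrable_mul_ac.
by apply: eq_Rintegral => t _; rewrite -mulrDr /S1 seriesSr.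
Qed.

Lemma picard_fixpoint :
  [/\ mu.-integrable `]a, d[ (EFin \o (fun x => P x * w x)),
   mu.-integrable `]a, d[ (EFin \o (fun x => V x * u x)),
   u d = al + \int[mu]_(t in `]a, d[) (P t * w t) &
   w d = be + \int[mu]_(t in `]a, d[) (V t * u t)].
Proof.
have dad : a <= d <= d by rewrite lexx ltW.
have [C SC] := S_bounded.
have mS f : abs_continuous a d f -> measurable_fun `]a, d[ f.
  move=> acf; apply: measurable_funS (abs_continuous_measurable acf) => //.
  exact: subset_itv_oo_cc.
have [i1 l1] := @cvg_integral_bounded_factor R a d P S2 w C iP
   (fun n => mS _ (S_ac n).2) (fun x h => S2_cvg (itv_oo_cc h))
   (fun n x h => (SC n x h).2).
have [i2 l2] := @cvg_integral_bounded_factor R a d V S1 u C iV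
   (fun n => mS _ (S_ac n).1) (fun x h => S1_cvg (itv_oo_cc h))
   (fun n x h => (SC n x h).1).
split=> //.
- have /(@cvg_lim _ _ _ _ _) <- // : S1 ^~ d \o S @ \oo --> 
    al + \int[mu]_(t in `]a, d[) (P t * w t).
    rewrite (_ : _ \o _ = (fun n => al + \int[mu]_(t in `]a, d[) (P t * S2 n t))).
      by apply: cvgD => //; exact: cvg_cst.
    by apply/funext => n; rewrite /= (S_step n).1.
  by apply/esym/cvg_lim => //; have := S1_cvg dad; rewrite -cvg_shiftS.
- have /(@cvg_lim _ _ _ _ _) <- // : S2 ^~ d \o S @ \oo --> 
    be + \int[mu]_(t in `]a, d[) (V t * u t).
    rewrite (_ : _ \o _ = (fun n => be + \int[mu]_(t in `]a, d[) (V t * S1 n t))).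
      by apply: cvgD => //; exact: cvg_cst.
    by apply/funext => n; rewrite /= (S_step n).2.
  by apply/esym/cvg_lim => //; have := S2_cvg dad; rewrite -cvg_shiftS.
Qed.

End Bounded.
End LinearSystem.

(** * Zeros of solutions of a linear system *)
Section StrictMonotone.
Context {R : realType}.
Local Notation mu := (@lebesgue_measure R).
Implicit Types (a c d x y : R) (f g : R -> R).

Lemma ae_witness x y (Q : R -> Prop) : x < y -> {ae mu, forall t, Q t} ->
  exists2 t, x < t < y & Q t.
Proof.
move=> xy [A [mA A0 QA]]; apply: contrapT => nex.
have : (mu `]x, y[ <= mu A)%E.
  apply: le_measure; rewrite ?inE//= => t; rewrite /= in_itv/= => xty.
  by apply: QA => /= Qt; apply: nex; exists t.
rewrite [X in (_ <= X)%E -> _]A0 lebesgue_measure_itv/= lte_fin xy -EFinD lee_fin.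
by rewrite subr_le0 leNgt xy.
Qed.

(** If f c = f d then the monotone f is constant, so that its derivative is zero,
but almost every point of the nonempty interval has a positive derivative. *)
Lemma ac_derive_increasing c d f f' : c < d -> ac_derive c d f f' ->
  {ae mu, forall x, c < x < d -> 0 < f' x} -> f c < f d.
Proof.
move=> cd acf f0.
have mono x y : c <= x -> x <= y -> y <= d -> f x <= f y.
  move=> cx xy yd; apply: (ac_derive_nondecreasing xy (ac_deriveS cx yd acf)).
  apply: aeS f0 => t h /andP[xt ty].
  by rewrite ltW// h// (le_lt_trans cx)// (lt_le_trans ty).
rewrite lt_neqAle mono// ?ltW// andbT; apply/negP => /eqP fcd.
have [t ctd [/(_ ctd) ft0 /(_ ctd) dft]] :=
  ae_witness cd (aeS2 (fun x h1 h2 => conj h1 h2) f0 acf.2).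
have /andP[ct td] := ctd.
have dft0 : is_derive t 1 f 0.
  apply: (@near_eq_is_derive _ _ _ (cst (f c))).
  near=> y; have /andP[cy yd] : c < y < d.
    by apply/andP; split; near: y; [exact: lt_nbhsr|exact: lt_nbhsl].
  by apply/eqP; rewrite eq_le mono ?(ltW cy) ?(ltW yd)//= {1}fcd mono// ltW.
have : f' t = 0 by case: dft => _ <-; case: dft0.
by move=> ft; rewrite ft ltxx in ft0.
Unshelve. all: by end_near. Qed.

(** At an accumulation point of zeros u vanishes, hence w does not and keeps its
sign nearby; as u' = P w with P > 0, u is strictly monotone there and cannot
have the two zeros that accumulation provides.  The point may be a itself. *)
Lemma system_zeros_finite a d e (P : R -> R) (u w : R -> R) : d < e ->
  ac_derive a e u (fun x => P x * w x) -> abs_continuous a e w ->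
  {ae mu, forall x, a < x < e -> 0 < P x} ->
  (forall x, a <= x <= d -> u x = 0 -> w x != 0) ->
  finite_set [set x | a <= x <= d /\ u x = 0].
Proof.
move=> de acu acw P0 uw0; set Z := [set x | _]; apply: contrapT => infZ.
have [c lim_c] : limit_point Z !=set0.
  apply: infinite_bounded_limit_point_nonempty => //.
  have [M [Mreal HM]] := @compact_bounded _ _ _ (@segment_compact R a d).
  exists M; split=> // M' MM' x [/andP[ax xd] _]; apply: (HM _ MM').
  by rewrite /= in_itv/= ax.
move/limit_point_infinite_setP in lim_c.
have Zc (r : R) : 0 < r -> exists x y, [/\ x < y, Z x, Z y, `|x - c| < r & `|y - c| < r].
  move=> r0; have /lim_c infU : nbhs c (ball c r) by exact: nbhsx_ballx.
  have [x [xc Zx]] : (ball c r `&` Z) !=set0.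
    by apply/set0P/eqP => E0; apply: infU; rewrite E0; exact: finite_set0.
  have [y [[yc Zy] yx]] : ((ball c r `&` Z) `\ x) !=set0.
    apply/set0P/eqP => E0; apply: infU.
    apply: (@sub_finite_set _ _ [set x]) => // y h; apply: contrapT => hx.
    by have : set0 y by rewrite -E0.
  move: xc yc; rewrite /ball/= ![`|c - _|]distrC => xc yc.
  have /eqP := yx; rewrite neq_lt => /orP[lt_yx|lt_xy]; first by exists y, x.
  by exists x, y.
have cad : a <= c <= d.
  apply/andP; split; rewrite leNgt; apply/negP => h.
    have [|x [y [_ [/andP[ax _] _] _ /ltr_normlP[_ xc] _]]] := Zc (a - c).
      by rewrite subr_gt0.
    by move: xc; rewrite ltrD2r ltNge ax.
  have [|x [y [_ [/andP[_ xd] _] _ /ltr_normlP[xc _] _]]] := Zc (c - d).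
    by rewrite subr_gt0.
  by move: xc; rewrite opprB ltrD2l ltrN2 ltNge xd.
have cae : a <= c <= e by case/andP: cad => -> /le_trans ->//; exact: ltW.
have Zae x : Z x -> a <= x <= e by move=> [/andP[-> /le_trans ->]]//; exact: ltW.
have uc : u c = 0.
  apply/eqP; apply: contrapT => /negP uc0.
  have uc0' : 0 < `|u c| by rewrite normr_gt0.
  have [r r0 Hr] := abs_continuous_unif acu.1 uc0'.
  have [x [_ [_ Zx _ xc _]]] := Zc r r0.
  by have := Hr c x cae (Zae x Zx) xc; rewrite Zx.2 sub0r normrN ltxx.
have wc : w c != 0 by exact: uw0.
have wc0 : 0 < `|w c| by rewrite normr_gt0.
have [r r0 Hr] := abs_continuous_unif acw wc0.
have [x [y [xy Zx Zy xc yc]]] := Zc r r0.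
have /andP[ax _] := Zae x Zx; have /andP[_ ye] := Zae y Zy.
have Hw t : x < t < y -> `|w t - w c| < `|w c|.
  move=> /andP[xt ty]; apply: Hr => //.
    by rewrite (le_trans ax (ltW xt)) (le_trans (ltW ty) ye).
  move: xc yc => /ltr_normlP[h1 _] /ltr_normlP[_ h2]; apply/ltr_normlP.
  by split; [move: h1 xt; lra|move: h2 ty; lra].
have acuxy := ac_deriveS ax ye acu.
have Pxy : {ae mu, forall t, x < t < y -> 0 < P t}.
  apply: aeS P0 => t h /andP[xt ty].
  by apply: h; rewrite (le_lt_trans ax)// (lt_le_trans ty).
move: wc; rewrite neq_lt => /orP[wneg|wpos].
  have : - u x < - u y.
    apply: (ac_derive_increasing xy (ac_deriveN acuxy)).
    apply: aeS Pxy => t h xty; rewrite -mulrN mulr_gt0 ?h// oppr_gt0.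
    by have /ltr_normlP[_] := Hw t xty; rewrite ltr0_norm//; lra.
  by rewrite Zx.2 Zy.2 ltxx.
have : u x < u y.
  apply: (ac_derive_increasing xy acuxy).
  apply: aeS Pxy => t h xty; rewrite mulr_gt0 ?h//.
  by have /ltr_normlP[+ _] := Hw t xty; rewrite gtr0_norm//; lra.
by rewrite Zx.2 Zy.2 ltxx.
Qed.

End StrictMonotone.

(** * Sturm-Liouville solutions as solutions of a linear system *)
Section Solutions.
Context {R : realType}.
Local Notation mu := (@lebesgue_measure R).
Variables (a : R) (b : \bar R).
Implicit Types (c d x y : R) (f g p q r u w : R -> R).

Lemma oo_itv_left x y : oo_itv a b y -> a < x -> x <= y -> oo_itv a b x.
Proof. by move=> [ay yb] ax xy; split=> //; rewrite (le_lt_trans _ yb)// lee_fin. Qed.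

Lemma oo_itv_gt d : oo_itv a b d -> exists2 e, d < e & oo_itv a b e.
Proof.
rewrite /oo_itv /=; case: b => [c||] [ad db].
- exists ((d + c) / 2); first by move: db; rewrite lte_fin; lra.
  by move: db; rewrite !lte_fin => db; split; lra.
- by exists (d + 1); [rewrite ltrDl|split; rewrite ?ltry//; lra].
- by move: db.
Qed.

Lemma segment_sub_oo_itv c d : a < c -> (d%:E < b)%E -> `[c, d] `<=` oo_itv a b.
Proof.
move=> ac db x /=; rewrite in_itv/= => /andP[cx xd].
by split; [exact: lt_le_trans cx|rewrite (le_lt_trans _ db)// lee_fin].
Qed.

Lemma locally_integrable_segment g c d : locally_integrable (oo_itv a b) g ->
  a < c -> (d%:E < b)%E -> mu.-integrable `[c, d] (EFin \o g).
Proof.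
move=> [mg og ig] ac db; apply/integrableP; split.
  apply/measurable_EFinP; apply: measurable_funS mg.
    exact: open_measurable.
  exact: segment_sub_oo_itv.
by apply: ig; [exact: segment_sub_oo_itv|exact: segment_compact].
Qed.

Lemma ac_loc_derive f g : locally_integrable (oo_itv a b) g ->
  (forall c d, `[c, d] `<=` oo_itv a b -> c <= d ->
     f d - f c = \int[mu]_(t in `[c, d]) g t) ->
  forall c d, a < c -> (d%:E < b)%E -> ac_derive c d f g.
Proof.
move=> ig H c d ac db; apply: ac_derive_increment.
  exact: locally_integrable_segment.
move=> x y cx xy yd; apply: H => //; apply: segment_sub_oo_itv.
  exact: lt_le_trans cx.
by rewrite (le_lt_trans _ db)// lee_fin.
Qed.

Lemma exhausting_sequence : (a%:E < b)%E -> exists e : nat -> R,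
  [/\ {homo e : n m / (n <= m)%N >-> n <= m}, forall n, ((e n)%:E < b)%E &
   forall x, (x%:E < b)%E -> exists n, x < e n].
Proof.
case: b => [y||] // _.
  exists (fun n => y - n.+1%:R^-1); split.
  - by move=> n m nm; rewrite lerD2l lerN2 lef_pV2 ?posrE// ler_nat.
  - by move=> n; rewrite lte_fin ltrBlDr ltrDl.
  - move=> x; rewrite lte_fin -subr_gt0 => yx.
    have [N _ HN] := near_infty_natSinv_lt (PosNum yx).
    exists N; have h : N.+1%:R^-1 < y - x := HN N (leqnn N).
    by rewrite ltrBrDl -ltrBrDr.
exists (fun n => n%:R); split.
- by move=> n m nm; rewrite ler_nat.
- by move=> n; rewrite ltry.
- by move=> x _; have [N _ HN] := nbhs_infty_gtr x; exists N; apply: HN => /=.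
Qed.

Lemma ae_oo_itv (Q : R -> Prop) :
  (forall c d, a < c -> (d%:E < b)%E -> {ae mu, forall x, c < x < d -> Q x}) ->
  {ae mu, forall x, oo_itv a b x -> Q x}.
Proof.
move=> H; have [ab|nab] := pselect (a%:E < b)%E; last first.
  by apply: aeW => x [ax xb]; case: nab; rewrite (lt_trans _ xb).
have [e [_ eb e_cof]] := exhausting_sequence ab.
pose c n : R := a + n.+1%:R^-1.
have ac n : a < c n by rewrite /c ltrDl.
have : {ae mu, forall x n m, c n < x < e m -> Q x}.
  by apply: ae_foralln => n; apply: ae_foralln => m; exact: H.
apply: aeS => x Hx [ax /e_cof[m xm]].
have : 0 < x - a by rewrite subr_gt0.
move=> xa; have [N _ HN] := near_infty_natSinv_lt (PosNum xa).
apply: (Hx N m); rewrite xm andbT.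
have h : N.+1%:R^-1 < x - a := HN N (leqnn N).
by rewrite /c -ltrBrDl.
Qed.

(** The first-order system for u and its quasi-derivative w = p u'. *)
Definition solution_pair p q r E u w := forall c d, a < c -> (d%:E < b)%E ->
  ac_derive c d u (fun x => (p x)^-1 * w x) /\
  ac_derive c d w (fun x => (q x - E * r x) * u x).

Lemma sl_solutionP p q r E u : sl_coefficients a b p q r ->
  sl_solution (oo_itv a b) p q r E u ->
  exists2 w, solution_pair p q r E u w &
    {ae mu, forall x, oo_itv a b x -> w x = p x * derive1 u x}.
Proof.
move=> [pos _] [w [[gu igu Hu] [gw igw Hw] wE wE']]; exists w => // c d ac db.
have [acu dgu] := ac_loc_derive igu Hu ac db.
have [acw dgw] := ac_loc_derive igw Hw ac db.
have Icd x : c < x < d -> oo_itv a b x.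
  move=> /andP[cx xd]; apply: (segment_sub_oo_itv ac db).
  by rewrite /= in_itv/= !ltW.
split.
  apply: (@ac_derive_ae _ _ _ _ gu); first by split.
  apply: aeS2 (aeS2 (fun x h1 h2 => conj h1 h2) dgu pos) wE => x [h1 h2] h3 xcd.
  have [px _] := h2 (Icd x xcd).
  rewrite h3; last exact: Icd.
  rewrite derive1E; have [_ ->] := h1 xcd.
  by rewrite mulKf// gt_eqF.
apply: (@ac_derive_ae _ _ _ _ gw); first by split.
apply: aeS2 dgw wE' => x h1 h2 xcd.
have := h2 (Icd x xcd); rewrite derive1E; have [_ ->] := h1 xcd.
by move=> h; rewrite mulrBl; move: h; lra.
Qed.

End Solutions.

Section Existence.
Context {R : realType}.
Local Notation mu := (@lebesgue_measure R).
Variables (a : R) (b : \bar R).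
Implicit Types (c d x y : R) (f g p q r u w P V : R -> R).

(** The solution is the sum of the Picard series on (a, b), replaced by its
integral equation so that it also has the right values at a. *)
Lemma linear_ivp P V (al be : R) :
  (forall d, oo_itv a b d -> mu.-integrable `]a, d[ (EFin \o P)) ->
  (forall d, oo_itv a b d -> mu.-integrable `]a, d[ (EFin \o V)) ->
  exists u w, [/\ u a = al, w a = be & forall d, oo_itv a b d ->
    ac_derive a d u (fun x => P x * w x) /\ ac_derive a d w (fun x => V x * u x)].
Proof.
move=> iP iV.
pose u0 x := limn (series (fun k => (picard a P V al be k).1 x)).
pose w0 x := limn (series (fun k => (picard a P V al be k).2 x)).
have H d : oo_itv a b d -> [/\ mu.-integrable `]a, d[ (EFin \o (fun x => P x * w0 x)),
   mu.-integrable `]a, d[ (EFin \o (fun x => V x * u0 x)),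
   u0 d = al + \int[mu]_(t in `]a, d[) (P t * w0 t) &
   w0 d = be + \int[mu]_(t in `]a, d[) (V t * u0 t)].
  by move=> Id; apply: picard_fixpoint; [case: Id|exact: iP|exact: iV].
pose u x := al + \int[mu]_(t in `]a, x[) (P t * w0 t).
pose w x := be + \int[mu]_(t in `]a, x[) (V t * u0 t).
exists u, w; split; [by rewrite /u set_itvoo0 Rintegral_set0 addr0|
  by rewrite /w set_itvoo0 Rintegral_set0 addr0|].
move=> d Id; have [i1 i2 _ _] := H d Id.
have E x : a < x < d -> u0 x = u x /\ w0 x = w x.
  move=> /andP[ax xd]; have [|_ _ -> ->] := H x; last by [].
  by apply: oo_itv_left Id ax _; exact: ltW.
split.
  have /ac_derive_ae := ac_deriveD (ac_derive_cst a d al) (primitive_ac_derive i1).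
  by apply; apply: aeW => x /E[_ ->]; rewrite add0r.
have /ac_derive_ae := ac_deriveD (ac_derive_cst a d be) (primitive_ac_derive i2).
by apply; apply: aeW => x /E[-> _]; rewrite add0r.
Qed.

Lemma integrable_near_left f c : oo_itv a b c ->
  mu.-integrable `]a, c[ (EFin \o f) -> locally_integrable (oo_itv a b) f ->
  forall d, oo_itv a b d -> mu.-integrable `]a, d[ (EFin \o f).
Proof.
move=> [ac cb] i1 lf d [ad db].
have i2 := locally_integrable_segment lf ac db.
have j1 : mu.-integrable setT (EFin \o (f \_ `]a, c[)).
  by rewrite -restrict_EFin; apply/integrable_restrict => //; rewrite setTI.
have j2 : mu.-integrable setT (EFin \o (f \_ `[c, d])).
  by rewrite -restrict_EFin; apply/integrable_restrict => //; rewrite setTI.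
have := integrable_itv `]a, d[ (integrable_add measurableT j1 j2).
apply: eq_integrable => // x; rewrite inE/= in_itv/= => /andP[ax xd].
congr EFin; rewrite !patchE; have [xc|cx] := ltP x c.
  rewrite ifT ?inE/= ?in_itv/= ?ax//.
  by rewrite ifF ?addr0// memNset//= in_itv/= leNgt xc.
rewrite ifF; last by rewrite memNset//= in_itv/= [x < c]ltNge cx andbF.
by rewrite ifT ?add0r// inE/= in_itv/= cx ltW.
Qed.

Lemma ac_derive_integral c d f f' : c <= d -> mu.-integrable `[c, d] (EFin \o f') ->
  ac_derive c d f f' -> f d - f c = \int[mu]_(t in `[c, d]) f' t.
Proof.
move=> cd int_f' acf.
have i : mu.-integrable `]c, d[ (EFin \o f').
  by apply: integrableS int_f' => //; exact: subset_itv_oo_cc.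
have : f d - \int[mu]_(t in `]c, d[) f' t = f c - \int[mu]_(t in `]c, c[) f' t.
  apply: (ac_derive_const cd (ac_deriveB acf (primitive_ac_derive i))).
  by apply: aeW => x _; rewrite subrr.
rewrite set_itvoo0 Rintegral_set0 subr0 Rintegral_oo_cc// => <-.
by rewrite opprB addrCA subrr addr0.
Qed.

Lemma locally_integrable_mul g f : locally_integrable (oo_itv a b) g ->
  (forall c d, a < c -> (d%:E < b)%E -> abs_continuous c d f) ->
  locally_integrable (oo_itv a b) (fun x => g x * f x).
Proof.
move=> lg acf; have [mg oI _] := lg; split=> //.
  apply: (@measurable_funM _ _ _ _ g f) => //.
  apply: open_continuous_measurable_fun => // x; rewrite inE => Ix.
  have [e xe [_ eb]] := oo_itv_gt Ix.
  have ax : a < (a + x) / 2 by case: Ix => + _; lra.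
  apply: (abs_continuous_at (acf _ _ ax eb)).
  by rewrite xe andbT; case: Ix => + _; lra.
move=> K KI cK; have [->|K0] := eqVneq K set0; first by rewrite integral_set0.
have idK : {within K, continuous (@idfun R)}.
  by apply: continuous_subspaceT => x; exact: cvg_id.
have NidK : {within K, continuous (fun x : R => - x)}.
  by apply: continuous_subspaceT => x; exact: opp_continuous.
move/set0P in K0.
have [d /set_mem Kd Hd] := compact_EVT_max K0 cK idK.
have [c /set_mem Kc Hc] := compact_EVT_max K0 cK NidK.
have [ac _] := KI c Kc; have [_ db] := KI d Kd.
have Kcd : K `<=` `[c, d].
  move=> x Kx; rewrite /= in_itv/=; apply/andP; split.
    by have := Hc x (mem_set Kx); rewrite lerN2.
  exact: Hd x (mem_set Kx).
have mK : measurable K by apply: closed_measurable; exact: compact_closed.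
have : mu.-integrable `[c, d] (EFin \o (fun x => g x * f x)).
  apply/integrable_oo_cc/integrable_mul_ac; first exact: acf.
  apply: integrableS (locally_integrable_segment lg ac db) => //.
  exact: subset_itv_oo_cc.
move=> i; have /integrableP[_ ] : mu.-integrable K (EFin \o (fun x => g x * f x)).
  by apply: integrableS i.
by [].
Qed.

Lemma solution_pair_sl p q r E u w : sl_coefficients a b p q r ->
  solution_pair a b p q r E u w -> sl_solution (oo_itv a b) p q r E u.
Proof.
move=> [pos [lp lq lr]] sol.
have acI : forall c d, a < c -> (d%:E < b)%E -> abs_continuous c d u /\ abs_continuous c d w.
  by move=> c d ac db; have [[]] := sol c d ac db; move=> ? _ [].
have lE : locally_integrable (oo_itv a b) (fun x => q x - E * r x).
  have := locally_integrableB lq (locally_integrable_mul lr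
    (fun c d _ _ => (ac_derive_cst c d E).1)).
  by rewrite (_ : (_ \- _) = (fun x => q x - E * r x))//; apply/funext => x/=; rewrite mulrC.
have oI : open (oo_itv a b) by case: lp.
have endpoints c d : `[c, d] `<=` oo_itv a b -> c <= d -> a < c /\ (d%:E < b)%E.
  move=> cdI cd; split.
    by have [] := cdI c; rewrite /= ?in_itv/= ?lexx.
  by have [] := cdI d; rewrite /= ?in_itv/= ?lexx ?andbT.
exists w; split.
- exists (fun x => (p x)^-1 * w x).
    by apply: locally_integrable_mul => // c d ac db; case: (acI c d ac db).
  move=> c d cdI cd; have [ac db] := endpoints c d cdI cd.
  apply: ac_derive_integral => //; last by case: (sol c d ac db).
  apply: (locally_integrable_segment _ ac db).
  by apply: locally_integrable_mul => // c' d' ac' db'; case: (acI c' d' ac' db').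
- exists (fun x => (q x - E * r x) * u x).
    by apply: locally_integrable_mul => // c d ac db; case: (acI c d ac db).
  move=> c d cdI cd; have [ac db] := endpoints c d cdI cd.
  apply: ac_derive_integral => //; last by case: (sol c d ac db).
  apply: (locally_integrable_segment _ ac db).
  by apply: locally_integrable_mul => // c' d' ac' db'; case: (acI c' d' ac' db').
- have : {ae mu, forall x, oo_itv a b x -> is_derive x 1 u ((p x)^-1 * w x)}.
    by apply: ae_oo_itv => c d ac db; case: (sol c d ac db) => -[].
  apply: aeS2 pos => x h1 h2 Ix; have [px _] := h1 Ix; rewrite derive1E.
  by have [_ ->] := h2 Ix; rewrite mulVKf// gt_eqF.
- have : {ae mu, forall x, oo_itv a b x -> is_derive x 1 w ((q x - E * r x) * u x)}.
    by apply: ae_oo_itv => c d ac db; case: (sol c d ac db) => _ [].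
  apply: aeS => x h Ix; rewrite derive1E.
  by have [_ ->] := h Ix; ring.
Qed.

(** Solutions are computed from a, where the coefficients are integrable.  The two
with initial data (1, 0) and (0, 1) have constant Wronskian 1, so a combination
of them takes prescribed values at x0; the same Wronskian shows that the
combination and its quasi-derivative have no common zero on [a, b). *)
Lemma solution_exists p q r E x0 y0 z0 : sl_coefficients a b p q r ->
  regular_left a b p q r -> oo_itv a b x0 -> (y0 != 0) || (z0 != 0) ->
  exists u w, [/\ solution_pair a b p q r E u w, u x0 = y0, w x0 = z0 &
    forall d, oo_itv a b d -> finite_set [set x | a <= x <= d /\ u x = 0]].
Proof.
move=> [pos [lp lq lr]] [c Ic [ip iq ir]] Ix0 yz0.
pose P x := (p x)^-1; pose V x := q x - E * r x.
have iP := integrable_near_left Ic ip lp.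
have iV d : oo_itv a b d -> mu.-integrable `]a, d[ (EFin \o V).
  move=> Id; have := integrable_add (measurable_itv _) (integrable_near_left Ic iq lq Id)
     (integrable_scale (- E) (measurable_itv _) (integrable_near_left Ic ir lr Id)).
  by rewrite (_ : (fun x => _) = V)//; apply/funext => x; rewrite mulNr.
have [u1 [w1 [u1a w1a sol1]]] := linear_ivp 1 0 iP iV.
have [u2 [w2 [u2a w2a sol2]]] := linear_ivp 0 1 iP iV.
have W1 d : oo_itv a b d -> u1 d * w2 d - u2 d * w1 d = 1.
  move=> Id; have [s1 t1] := sol1 d Id; have [s2 t2] := sol2 d Id.
  have ad : a <= d by apply: ltW; case: Id.
  rewrite (ac_derive_const ad (ac_deriveB (ac_deriveM s1 t2) (ac_deriveM s2 t1))).
    by rewrite u1a w1a u2a w2a; ring.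
  by apply: aeW => x _; rewrite -/(P x); ring.
(* Cramer's rule with determinant 1. *)
pose A := y0 * w2 x0 - z0 * u2 x0; pose B := u1 x0 * z0 - w1 x0 * y0.
pose u x := A * u1 x + B * u2 x; pose w x := A * w1 x + B * w2 x.
have sol d : oo_itv a b d ->
    ac_derive a d u (fun x => P x * w x) /\ ac_derive a d w (fun x => V x * u x).
  move=> Id; have [s1 t1] := sol1 d Id; have [s2 t2] := sol2 d Id; split.
    apply: ac_derive_ae (ac_deriveD (ac_deriveZ A s1) (ac_deriveZ B s2)) _.
    by apply: aeW => x _; rewrite /w -/(P x); ring.
  apply: ac_derive_ae (ac_deriveD (ac_deriveZ A t1) (ac_deriveZ B t2)) _.
  by apply: aeW => x _; rewrite /u; ring.
have ux0 : u x0 = y0.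
  have := W1 x0 Ix0; rewrite /u /A /B => h.
  by rewrite -[RHS]mulr1 -h; ring.
have wx0 : w x0 = z0.
  have := W1 x0 Ix0; rewrite /w /A /B => h.
  by rewrite -[RHS]mulr1 -h; ring.
have AB0 : (A != 0) || (B != 0).
  apply/negPn; rewrite negb_or !negbK; apply/negP => /andP[/eqP A0 /eqP B0].
  by move: yz0; rewrite -ux0 -wx0 /u /w A0 B0 !mul0r addr0 eqxx.
exists u, w; split=> //.
  move=> c' d' ac' db'; pose e := Num.max c d'.
  have Ie : oo_itv a b e.
    have [ac _] := Ic; rewrite /e maxEle; case: ifP => [cd'|//].
    by split=> //; exact: lt_le_trans cd'.
  have d'e : d' <= e by rewrite /e le_max lexx orbT.
  have [su sw] := sol e Ie.
  by split; [exact: ac_deriveS (ltW ac') d'e su|exact: ac_deriveS (ltW ac') d'e sw].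
move=> d Id; have [e de Ie] := oo_itv_gt Id.
have [s t] := sol e Ie.
apply: (@system_zeros_finite _ a d e P u w de s t.1).
  apply: aeS pos => x h /andP[ax xe]; rewrite invr_gt0.
  by have [] := h (oo_itv_left Ie ax (ltW xe)).
move=> x /andP[ax xd] ux; apply/negP => /eqP wx.
have W : u1 x * w2 x - u2 x * w1 x = 1.
  move: ax; rewrite le_eqVlt => /predU1P[<-|ax]; first by rewrite u1a w1a u2a w2a; ring.
  exact: W1 (oo_itv_left Id ax xd).
have A0 : A = 0.
  have -> : A = A * (u1 x * w2 x - u2 x * w1 x) by rewrite W mulr1.
  have -> : A * (u1 x * w2 x - u2 x * w1 x) = u x * w2 x - w x * u2 x.
    by rewrite /u /w; ring.
  by rewrite ux wx !mul0r subrr.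
have B0 : B = 0.
  have -> : B = B * (u1 x * w2 x - u2 x * w1 x) by rewrite W mulr1.
  have -> : B * (u1 x * w2 x - u2 x * w1 x) = w x * u1 x - u x * w1 x.
    by rewrite /u /w; ring.
  by rewrite ux wx !mul0r subrr.
by move: AB0; rewrite A0 B0 eqxx.
Qed.

End Existence.

(** * Iterated logarithms *)
Section IteratedLogarithms.
Context {R : realType}.
Local Notation mu := (@lebesgue_measure R).
Implicit Types (c d x y t : R) (s : R -> R).

(** Where the iterated logarithms up to order n are at least 1, they are genuine
logarithms (the absolute values disappear) and t <= L_j t for j <= n. *)
Definition log_large (n : nat) t := forall j, (j <= n)%N -> 1 <= iterlog j t.

(** The logarithmic derivative of sqrt(L_{k-1}). *)
Definition psi_log (k : nat) t : R := 2^-1 * \sum_(j < k) (Llog j t)^-1.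

Lemma log_large_le m n t : (m <= n)%N -> log_large n t -> log_large m t.
Proof. by move=> mn H j jm; apply: H; exact: leq_trans mn. Qed.

Lemma iterlog_ge j (A : R) : exists T, forall t, T <= t -> A <= iterlog j t.
Proof.
elim: j A => [|j IH] A; first by exists A.
have [T HT] := IH (expR A); exists T => t /HT h.
have j0 : 0 < iterlog j t by apply: lt_le_trans h; exact: expR_gt0.
by rewrite /iterlog iterS -/(iterlog j t) gtr0_norm// -[leLHS]expRK ler_ln ?posrE ?expR_gt0.
Qed.

Lemma log_large_near n : exists T, forall t, T <= t -> log_large n t.
Proof.
elim: n => [|n [T1 H1]].
  by exists 1 => t t1 [|//] _.
have [T2 H2] := iterlog_ge n.+1 1.
exists (Num.max T1 T2) => t; rewrite ge_max => /andP[t1 t2] j.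
by rewrite leq_eqVlt => /predU1P[->|]; [exact: H2|exact: H1].
Qed.

Lemma LlogS n t : Llog n.+1 t = Llog n t * iterlog n.+1 t.
Proof. by rewrite /Llog big_ord_recr. Qed.

Lemma Llog0 t : Llog 0 t = t.
Proof. by rewrite /Llog big_ord_recr big_ord0 /= mul1r. Qed.

Lemma Llog_ge n t : log_large n t -> t <= Llog n t.
Proof.
elim: n => [|n IH] H; first by rewrite Llog0.
have Hn := log_large_le (leqnSn n) H.
rewrite LlogS (le_trans (IH Hn))// ler_peMr//; last exact: H.
have /= t1 := H 0 (leq0n _).
by rewrite (le_trans ler01)// (le_trans t1)// IH.
Qed.

Lemma log_large_ge1 n t : log_large n t -> 1 <= t.
Proof. by move=> /(_ 0 (leq0n _)). Qed.

Lemma Llog_gt0 n j t : (j <= n)%N -> log_large n t -> 0 < Llog j t.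
Proof.
move=> jn H; have Hj := log_large_le jn H.
by rewrite (lt_le_trans _ (Llog_ge Hj))// (lt_le_trans _ (log_large_ge1 H)).
Qed.

Lemma psi_logS k t : psi_log k.+1 t = psi_log k t + 2^-1 * (Llog k t)^-1.
Proof. by rewrite /psi_log big_ord_recr mulrDr. Qed.

Lemma Qlog_S k t : Qlog k.+1 t = Qlog k t - 4^-1 * (Llog k t ^+ 2)^-1.
Proof. by rewrite /Qlog big_ord_recr/=; ring. Qed.

Lemma psi_log_ge0 n k t : (k <= n.+1)%N -> log_large n t -> 0 <= psi_log k t.
Proof.
move=> kn H; rewrite mulr_ge0 ?invr_ge0// sumr_ge0// => j _.
rewrite invr_ge0 ltW// (@Llog_gt0 n)//.
by rewrite -ltnS (leq_trans (ltn_ord j)).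
Qed.

Lemma psi_log_le n k t : (k <= n.+1)%N -> log_large n t -> t * psi_log k t <= k%:R.
Proof.
elim: k => [|k IH] kn H; first by rewrite /psi_log big_ord0 !mulr0.
rewrite psi_logS mulrDr -(natr1 k) lerD ?IH// 1?ltnW//.
have t0 : 0 < t by rewrite (lt_le_trans _ (log_large_ge1 H)).
have kt : t <= Llog k t by apply: Llog_ge; apply: log_large_le H.
have L0 : 0 < Llog k t by exact: lt_le_trans kt.
have h : t / Llog k t <= 1 by rewrite ler_pdivrMr// mul1r.
have h0 : 0 <= t / Llog k t by rewrite divr_ge0 ?ltW.
rewrite mulrCA; move: h h0; lra.
Qed.

Lemma ac_derive_eq c d (f g f' : R -> R) : (forall x, c <= x <= d -> f x = g x) ->
  ac_derive c d f f' -> ac_derive c d g f'.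
Proof.
move=> fg [acf df]; split.
  apply: (abs_continuous_le ler01 acf) => x y cx xy yd.
  rewrite mul1r -!fg//; first by rewrite cx (le_trans xy).
  by rewrite yd (le_trans cx).
apply: aeS df => x h /[dup] /h {}h /andP[cx xd].
apply: near_eq_is_derive h; near=> y.
have /andP[cy yd] : c < y < d.
  by apply/andP; split; near: y; [exact: lt_nbhsr|exact: lt_nbhsl].
by apply: fg; rewrite !ltW.
Unshelve. all: by end_near. Qed.

Section Composition.
Variables (n : nat) (c d : R) (s s' : R -> R).
Hypotheses (cd : c <= d) (acs : ac_derive c d s s').
Hypothesis large_s : forall x, c <= x <= d -> log_large n (s x).

Lemma ac_derive_iterlogS j : (j <= n)%N ->
  ac_derive c d (fun x => iterlog j.+1 (s x)) (fun x => s' x / Llog j (s x)).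
Proof.
elim: j => [|j IH] jn.
  apply: (@ac_derive_eq _ _ (fun x => ln (s x))).
    move=> x /large_s/log_large_ge1 s1; rewrite /iterlog/= ger0_norm//.
    exact: le_trans s1.
  have /ac_derive_ae : ac_derive c d (fun x => ln (s x)) (fun x => s' x / s x).
    apply: ac_derive_ln => // x /large_s/log_large_ge1.
    exact: lt_le_trans.
  by apply; apply: aeW => x _; rewrite Llog0.
apply: (@ac_derive_eq _ _ (fun x => ln (iterlog j.+1 (s x)))).
  move=> x /large_s/(_ _ jn) s1; rewrite [RHS]/iterlog iterS -/(iterlog j.+1 (s x)).
  by rewrite ger0_norm//; exact: le_trans s1.
have /ac_derive_ae : ac_derive c d (fun x => ln (iterlog j.+1 (s x)))
   (fun x => s' x / Llog j (s x) / iterlog j.+1 (s x)).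
  apply: ac_derive_ln => //; first by apply: IH; exact: ltnW.
  by move=> x /large_s/(_ _ jn); exact: lt_le_trans.
by apply; apply: aeW => x _; rewrite LlogS invfM mulrA.
Qed.

Lemma ac_derive_Llog j : (j <= n)%N ->
  ac_derive c d (fun x => Llog j (s x))
    (fun x => s' x * (Llog j (s x) * (2 * psi_log j.+1 (s x)))).
Proof.
elim: j => [|j IH] jn.
  rewrite (_ : (fun x => Llog 0 (s x)) = s); last by apply/funext => x; rewrite Llog0.
  apply: ac_derive_ae acs _; apply: aeW => x xcd.
  rewrite psi_logS /psi_log big_ord0 mulr0 add0r Llog0.
  have /large_s/log_large_ge1 s1 : c <= x <= d by exact: itv_oo_cc.
  have s0 : s x != 0 by rewrite gt_eqF// (lt_le_trans _ s1).
  by field.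
rewrite (_ : (fun x => Llog j.+1 (s x)) = (fun x => Llog j (s x) * iterlog j.+1 (s x))); last first.
  by apply/funext => x; rewrite LlogS.
apply: ac_derive_ae (ac_deriveM (IH (ltnW jn)) (ac_derive_iterlogS (ltnW jn))) _.
apply: aeW => x /itv_oo_cc /large_s lx.
have L0 : Llog j.+1 (s x) != 0 by rewrite gt_eqF// (Llog_gt0 jn).
have L1 : Llog j (s x) != 0 by rewrite gt_eqF// (Llog_gt0 (ltnW jn)).
have i0 : iterlog j.+1 (s x) != 0 by move: L0; rewrite LlogS mulf_eq0 negb_or => /andP[].
rewrite (psi_logS j.+1) !LlogS.
by field; rewrite L1 i0.
Qed.

(** The Riccati form psi' + psi^2 = Q_k of y'' = Q_k y for y = sqrt(L_{k-1}). *)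
Lemma ac_derive_psi_log k : (k <= n.+1)%N ->
  ac_derive c d (fun x => psi_log k (s x))
    (fun x => s' x * (Qlog k (s x) - psi_log k (s x) ^+ 2)).
Proof.
elim: k => [|k IH] kn.
  rewrite (_ : (fun x => psi_log 0 (s x)) = cst 0); last first.
    by apply/funext => x; rewrite /psi_log big_ord0 mulr0.
  apply: ac_derive_ae (ac_derive_cst c d 0) _; apply: aeW => x _.
  by rewrite /psi_log /Qlog !big_ord0 /=; ring.
rewrite (_ : (fun x => _) = (fun x => psi_log k (s x) + 2^-1 * (Llog k (s x))^-1)); last first.
  by apply/funext => x; rewrite psi_logS.
have Lk0 x : c <= x <= d -> Llog k (s x) != 0.
  by move=> /large_s lx; rewrite gt_eqF// (@Llog_gt0 n).
apply: ac_derive_ae (ac_deriveD (IH (ltnW kn))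
  (ac_deriveZ (2^-1) (ac_deriveV cd (ac_derive_Llog kn) Lk0))) _.
apply: aeW => x /itv_oo_cc /Lk0 L0; rewrite psi_logS Qlog_S.
by field.
Qed.

End Composition.
End IteratedLogarithms.

(** * Negligible terms *)
Section Perturbation.
Context {R : realType}.
Variables (A B L psi s N eps : R).
Hypotheses (s_ge1 : 1 <= s) (s_le : s <= L) (psi0 : 0 <= psi) (spsi : s * psi <= N).
Hypotheses (hA : `|A| <= eps * (s ^+ 2 / L ^+ 2)) (hB : `|B| <= eps * (s / L ^+ 2)).

Let s0 : 0 < s. Proof. exact: lt_le_trans s_ge1. Qed.
Let L0 : 0 < L. Proof. exact: lt_le_trans s_le. Qed.
Let eps0 : 0 <= eps.
Proof.
have : 0 <= eps * (s / L ^+ 2) by exact: le_trans hB.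
by rewrite pmulr_lge0// divr_gt0// exprn_gt0.
Qed.
Let N0 : 0 <= N. Proof. by apply: le_trans spsi; rewrite mulr_ge0// ltW. Qed.
Let L2B : `|L ^+ 2 * B| <= eps * s.
Proof.
rewrite normrM gtr0_norm ?exprn_gt0//.
rewrite -ler_pdivlMl ?exprn_gt0// (le_trans hB)//.
by rewrite mulrA mulrC.
Qed.
Let L2A : `|L ^+ 2 * A| <= eps * s ^+ 2.
Proof.
rewrite normrM gtr0_norm ?exprn_gt0//.
rewrite -ler_pdivlMl ?exprn_gt0// (le_trans hA)//.
by rewrite mulrA mulrC.
Qed.

(** These three bounds depend on s, L and psi only through N and eps: this is
where s <= L and s psi <= N absorb the growth of s. *)
Lemma perturbation_const :
  `|L ^+ 2 * (2 * B * psi + A * psi ^+ 2)| <= eps * (2 * N + N ^+ 2).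
Proof.
have hB' : `|L ^+ 2 * B * psi| <= eps * N.
  rewrite normrM (ger0_norm psi0) (le_trans (ler_wpM2r psi0 L2B))//.
  by rewrite -mulrA ler_wpM2l.
have hA' : `|L ^+ 2 * A * psi ^+ 2| <= eps * N ^+ 2.
  rewrite normrM [`|psi ^+ 2|]ger0_norm ?sqr_ge0//.
  rewrite (le_trans (ler_wpM2r (sqr_ge0 psi) L2A))//.
  rewrite -mulrA ler_wpM2l// -exprMn ler_pXn2r// nnegrE//.
  by rewrite mulr_ge0// ltW.
move: hB' hA'; rewrite !ler_norml => /andP[h1 h2] /andP[h3 h4].
by apply/andP; split; lra.
Qed.

Lemma perturbation_linear : `|L * (2 * B + 2 * A * psi)| <= 2 * eps * (1 + N).
Proof.
have hB' : `|L * B| <= eps.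
  rewrite -(ler_pM2l L0) -[X in X * `|_|](gtr0_norm L0) -normrM mulrA -expr2.
  by rewrite (le_trans L2B)// mulrC ler_wpM2r.
have hA' : `|L * A * psi| <= eps * N.
  rewrite -(ler_pM2l L0) -[X in X * `|_|](gtr0_norm L0) -normrM !mulrA -expr2.
  rewrite normrM (ger0_norm psi0) (le_trans (ler_wpM2r psi0 L2A))//.
  have -> : eps * s ^+ 2 * psi = eps * (s * (s * psi)) by ring.
  rewrite [L * _]mulrC -!mulrA ler_wpM2l// ler_pM//; first exact: ltW.
  by rewrite mulr_ge0// ltW.
move: hB' hA'; rewrite !ler_norml => /andP[h1 h2] /andP[h3 h4].
by apply/andP; split; lra.
Qed.

Lemma perturbation_square : `|A| <= eps.
Proof.
apply: le_trans hA _; rewrite -[leRHS]mulr1 ler_wpM2l//.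
by rewrite ler_pdivrMr ?exprn_gt0// mul1r ler_pXn2r// nnegrE ltW.
Qed.

(** The quantity bounded below is the coefficient of Y^2 in the s-derivative of
Y (Z - psi Y), see nonvanishing_product, with Q_{n+1} = Q_n - 1/(4 L^2). *)
Lemma comparison_lower C Q k : eps * (2 * N + N ^+ 2) <= k ->
  - 4^-1 + k <= L ^+ 2 * (C - Q) ->
  0 <= C - (Q - 4^-1 * (L ^+ 2)^-1) + 2 * B * psi + A * psi ^+ 2.
Proof.
move=> epsk hC; have L2 : 0 < L ^+ 2 by rewrite exprn_gt0.
rewrite -(pmulr_rge0 _ L2).
have -> : L ^+ 2 * (C - (Q - 4^-1 * (L ^+ 2)^-1) + 2 * B * psi + A * psi ^+ 2) =
   L ^+ 2 * (C - Q) + 4^-1 + L ^+ 2 * (2 * B * psi + A * psi ^+ 2).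
  by field; rewrite gt_eqF.
have := perturbation_const; rewrite ler_norml => /andP[+ _].
move: hC epsk; lra.
Qed.

(** The left-hand side is L dh/ds for h = L (Z/Y - psi), see riccati_atan_bound,
with Q_{n+1} = Q_n - 1/(4 L^2).  Up to multiples of eps, its constant term is at
most - k and its quadratic term is - h^2; the linear one is split by
2 |h| <= 1 + h^2. *)
Lemma comparison_upper C Q k m h : eps * (N ^+ 2 + 3 * N + 2) <= m ->
  2 * m <= k -> 2 * m <= 1 -> L ^+ 2 * (C - Q) <= - 4^-1 - k ->
  L ^+ 2 * (C - (Q - 4^-1 * (L ^+ 2)^-1)) +
   L ^+ 2 * (2 * B * psi + A * psi ^+ 2) + L * (2 * B + 2 * A * psi) * h
   - (1 - A) * h ^+ 2 <= - m * (1 + h ^+ 2).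
Proof.
move=> epsm mk m1 hC; have L2 : 0 < L ^+ 2 by rewrite exprn_gt0.
have -> : L ^+ 2 * (C - (Q - 4^-1 * (L ^+ 2)^-1)) = L ^+ 2 * (C - Q) + 4^-1.
  by field; rewrite gt_eqF.
have h1 := perturbation_const; have h2 := perturbation_linear.
have h3 := perturbation_square.
have {}h1 : L ^+ 2 * (2 * B * psi + A * psi ^+ 2) <= eps * (2 * N + N ^+ 2).
  by rewrite (le_trans (ler_norm _)).
have {}h3 : A * h ^+ 2 <= eps * h ^+ 2.
  by rewrite ler_wpM2r ?sqr_ge0// (le_trans (ler_norm _)).
have {}h2 : L * (2 * B + 2 * A * psi) * h <= eps * (1 + N) * (1 + h ^+ 2).
  rewrite (le_trans (ler_norm _))// normrM.
  rewrite (@le_trans _ _ (2 * eps * (1 + N) * `|h|))// ?ler_wpM2r//.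
  have -> : 2 * eps * (1 + N) * `|h| = eps * (1 + N) * (2 * `|h|) by ring.
  rewrite ler_wpM2l ?mulr_ge0 ?addr_ge0//.
  by have := sqr_ge0 (1 - `|h|); rewrite -(real_normK (num_real h)); nra.
have hh := sqr_ge0 h.
have e1 : eps * (1 + N) * (1 + h ^+ 2) = eps * (1 + N) + eps * (1 + N) * h ^+ 2 by ring.
have e2 : eps * (N ^+ 2 + 3 * N + 2) = eps * (2 * N + N ^+ 2) + eps * (1 + N) + eps by ring.
have b0 : 0 <= eps * (1 + N) by rewrite mulr_ge0 ?addr_ge0.
have b1 : 0 <= eps * (2 * N + N ^+ 2) by rewrite mulr_ge0// addr_ge0 ?mulr_ge0 ?sqr_ge0.
have b2 : eps * (1 + N) * h ^+ 2 + eps * h ^+ 2 <= m * h ^+ 2.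
  by rewrite -mulrDl ler_wpM2r//; move: epsm e2 b0 b1 eps0; lra.
have b3 : m * h ^+ 2 <= (1 - m) * h ^+ 2 by rewrite ler_wpM2r//; lra.
have -> : (1 - A) * h ^+ 2 = h ^+ 2 - A * h ^+ 2 by ring.
have -> : - m * (1 + h ^+ 2) = - m - m * h ^+ 2 by ring.
have b4 : (1 - m) * h ^+ 2 = h ^+ 2 - m * h ^+ 2 by ring.
move: h1 h2 h3 hC epsm mk e1 e2 b2 b3 b4 b0 b1 eps0; lra.
Qed.

End Perturbation.

(** * Comparison with the borderline equation *)
Section Comparison.
Context {R : realType}.
Local Notation mu := (@lebesgue_measure R).
Variables (a : R) (b : \bar R) (p0 q0 p1 q1 r u0 w0 u w s : R -> R) (E : R).
Hypothesis p0_gt0 : {ae mu, forall x, oo_itv a b x -> 0 < p0 x}.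
Hypothesis p1_gt0 : {ae mu, forall x, oo_itv a b x -> 0 < p1 x}.
Hypothesis u0_gt0 : forall x, oo_itv a b x -> 0 < u0 x.
Hypothesis sol0 : solution_pair a b p0 q0 r E u0 w0.
Hypothesis sol1 : solution_pair a b p1 q1 r E u w.

Let Dp x := (p0 x)^-1 - (p1 x)^-1.
Let Dq x := q1 x - q0 x.
Let sg x := (p0 x * u0 x ^+ 2)^-1.
Let A x := p0 x * Dp x.
Let B x := p0 x * u0 x * w0 x * Dp x.
Let C x := p0 x * u0 x ^+ 2 * (u0 x ^+ 2 * Dq x + w0 x ^+ 2 * Dp x).
Let Y x := u x / u0 x.
Let Z x := u0 x * w x - w0 x * u x.

Hypothesis ac_s : forall c d, a < c -> (d%:E < b)%E -> ac_derive c d s sg.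

Let Icd c d x : a < c -> (d%:E < b)%E -> c <= x <= d -> oo_itv a b x.
Proof. by move=> ac db h; apply: (segment_sub_oo_itv ac db); rewrite /= in_itv. Qed.

(** sg is ds/dx, so this is the system for Y and Z in the variable s. *)
Lemma comparison_system c d : a < c -> c <= d -> (d%:E < b)%E ->
  ac_derive c d Y (fun x => sg x * ((1 - A x) * Z x - B x * Y x)) /\
  ac_derive c d Z (fun x => sg x * (B x * Z x + C x * Y x)).
Proof.
move=> ac cd db.
have [du0 dw0] := sol0 ac db; have [du dw] := sol1 ac db.
have u0n x : c <= x <= d -> u0 x != 0.
  by move=> h; rewrite gt_eqF// u0_gt0//; exact: Icd h.
have pp : {ae mu, forall x, c < x < d -> 0 < p0 x /\ 0 < p1 x}.
  apply: aeS2 p0_gt0 p1_gt0 => x h1 h2 /itv_oo_cc /(Icd ac db) Ix.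
  by split; [exact: h1|exact: h2].
split.
  apply: ac_derive_ae (ac_deriveM du (ac_deriveV cd du0 u0n)) _.
  apply: aeS pp => x H xcd; have [p00 p10] := H xcd.
  have u0x := u0n x (itv_oo_cc xcd).
  rewrite /sg /A /B /Y /Z /Dp.
  by field; rewrite u0x !gt_eqF.
apply: ac_derive_ae (ac_deriveB (ac_deriveM du0 dw) (ac_deriveM dw0 du)) _.
apply: aeS pp => x H xcd; have [p00 p10] := H xcd.
have u0x := u0n x (itv_oo_cc xcd).
rewrite /sg /A /B /C /Y /Z /Dp /Dq.
by field; rewrite u0x !gt_eqF.
Qed.

Variables (n : nat) (x0 : R).
Hypothesis Ix0 : oo_itv a b x0.
Hypothesis large_s : forall x, oo_itv a b x -> x0 <= x -> log_large n (s x).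
Let psi x := psi_log n.+1 (s x).
Let L x := Llog n (s x).

Let sg_gt0 : {ae mu, forall x, oo_itv a b x -> 0 < sg x /\ 0 < 1 - A x}.
Proof.
apply: aeS2 p0_gt0 p1_gt0 => x h1 h2 Ix; have p00 := h1 Ix; have p10 := h2 Ix.
split; first by rewrite invr_gt0 mulr_gt0// exprn_gt0// u0_gt0.
have -> : 1 - A x = p0 x / p1 x by rewrite /A /Dp; field; rewrite !gt_eqF.
by rewrite divr_gt0.
Qed.

(** The derivative of Y (Z - psi Y) is sg times
(1 - A) (Z - psi Y)^2 + (C - Q_{n+1} + 2 B psi + A psi^2) Y^2, a sum of two
nonnegative terms. *)
Lemma nonvanishing_product :
  {ae mu, forall x, oo_itv a b x -> x0 < x ->
    0 <= C x - Qlog n.+1 (s x) + 2 * B x * psi x + A x * psi x ^+ 2} ->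
  forall d, oo_itv a b d -> x0 <= d ->
    Y x0 * (Z x0 - psi x0 * Y x0) <= Y d * (Z d - psi d * Y d).
Proof.
move=> G0 d [ad db] x0d; have [ax0 _] := Ix0.
have [dY dZ] := comparison_system ax0 x0d db.
have dpsi : ac_derive x0 d psi _ := ac_derive_psi_log x0d (ac_s ax0 db)
  (fun x h => large_s (Icd ax0 db h) (proj1 (andP h))) (leqnn n.+1).
have H := ac_deriveM dY (ac_deriveB dZ (ac_deriveM dpsi dY)).
apply: (ac_derive_nondecreasing x0d H).
apply: aeS2 sg_gt0 G0 => x h1 h2 x0xd.
have Ix := Icd ax0 db (itv_oo_cc x0xd).
have [sg0 A1] := h1 Ix; have G := h2 Ix (proj1 (andP x0xd)).
set W := Z x - psi x * Y x.
have -> : sg x * ((1 - A x) * Z x - B x * Y x) * (Z x - psi x * Y x) +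
   Y x * (sg x * (B x * Z x + C x * Y x) -
     (sg x * (Qlog n.+1 (s x) - psi_log n.+1 (s x) ^+ 2) * Y x +
        psi x * (sg x * ((1 - A x) * Z x - B x * Y x)))) =
   sg x * ((1 - A x) * W ^+ 2 +
     (C x - Qlog n.+1 (s x) + 2 * B x * psi x + A x * psi x ^+ 2) * Y x ^+ 2).
  by rewrite -/(psi x) /W; ring.
apply: mulr_ge0; first exact: ltW.
by apply: addr_ge0; apply: mulr_ge0; rewrite ?sqr_ge0//; exact: ltW.
Qed.

(** Along h = L (Z/Y - psi) the function atan h + m log_{n+1}(s) is nonincreasing,
and atan has total variation at most pi. *)
Lemma riccati_atan_bound m : 0 < m ->
  (forall x, oo_itv a b x -> x0 <= x -> u x != 0) ->
  {ae mu, forall x, oo_itv a b x -> x0 < x -> forall h,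
    L x ^+ 2 * (C x - Qlog n.+1 (s x)) +
     L x ^+ 2 * (2 * B x * psi x + A x * psi x ^+ 2) +
     L x * (2 * B x + 2 * A x * psi x) * h - (1 - A x) * h ^+ 2 <= - m * (1 + h ^+ 2)} ->
  forall d, oo_itv a b d -> x0 <= d ->
    m * iterlog n.+1 (s d) <= m * iterlog n.+1 (s x0) + pi.
Proof.
move=> m0 un0 G0 d [ad db] x0d; have [ax0 _] := Ix0.
have [dY dZ] := comparison_system ax0 x0d db.
have largex x : x0 <= x <= d -> log_large n (s x).
  by move=> h; exact: large_s (Icd ax0 db h) (proj1 (andP h)).
have dpsi : ac_derive x0 d psi _ :=
  ac_derive_psi_log x0d (ac_s ax0 db) largex (leqnn n.+1).
have dL : ac_derive x0 d L _ :=
  ac_derive_Llog x0d (ac_s ax0 db) largex (leqnn n).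
have dlog := ac_derive_iterlogS x0d (ac_s ax0 db) largex (leqnn n).
have Yn0 x : x0 <= x <= d -> Y x != 0.
  move=> h; have Ix := Icd ax0 db h.
  by rewrite mulf_neq0 ?invr_eq0 ?(gt_eqF (u0_gt0 Ix))// un0//; case/andP: h.
pose h x := L x * (Z x * (Y x)^-1 - psi x).
have dh := ac_deriveM dL (ac_deriveB (ac_deriveM dZ (ac_deriveV x0d dY Yn0)) dpsi).
have H := ac_deriveD (ac_derive_atan dh) (ac_deriveZ m dlog).
have : atan (h d) + m * iterlog n.+1 (s d) <= atan (h x0) + m * iterlog n.+1 (s x0).
  apply: (ac_derive_nonincreasing x0d H).
  apply: aeS2 sg_gt0 G0 => x h1 h2 x0xd.
  have Ix := Icd ax0 db (itv_oo_cc x0xd).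
  have [sg0 A1] := h1 Ix; have {h2} G := h2 Ix (proj1 (andP x0xd)) (h x).
  have Yx := Yn0 x (itv_oo_cc x0xd).
  have L0 : 0 < L x by apply: (@Llog_gt0 _ n) => //; apply: largex; exact: itv_oo_cc.
  have hx2 : 0 < 1 + h x ^+ 2 by rewrite ltr_pwDl// sqr_ge0.
  rewrite -/(L x) -/(psi x) -/(h x).
  set D := (X in X / (1 + h x ^+ 2)).
  have DE : D = sg x / L x * (L x ^+ 2 * (C x - Qlog n.+1 (s x)) +
     L x ^+ 2 * (2 * B x * psi x + A x * psi x ^+ 2) +
     L x * (2 * B x + 2 * A x * psi x) * h x - (1 - A x) * h x ^+ 2).
    by rewrite /D /h; field; rewrite Yx gt_eqF.
  have DL : D <= sg x / L x * (- m * (1 + h x ^+ 2)).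
    by rewrite DE ler_wpM2l// divr_ge0// ltW.
  rewrite -lerBrDr sub0r ler_pdivrMr// (le_trans DL)//.
  by rewrite le_eqVlt; apply/orP; left; apply/eqP; ring.
have := atan_ltpi2 (h x0); have := atan_gtNpi2 (h d).
lra.
Qed.

End Comparison.

(** * The right endpoint *)
Section Endpoint.
Context {R : realType}.
Local Notation mu := (@lebesgue_measure R).
Variables (a : R) (b : \bar R).
Hypothesis ab : (a%:E < b)%E.
Implicit Types (c d x y : R).

Lemma oo_itv_nonempty : exists c, oo_itv a b c.
Proof.
move: ab; rewrite /oo_itv /=; case: b => [y||] // h.
  by exists ((a + y) / 2); move: h; rewrite !lte_fin => h; split; lra.
by exists (a + 1); rewrite ltry; split=> //; lra.
Qed.

Lemma nbhs_left_endpoint (U : set (\bar R)) : nbhs b U ->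
  exists2 c, oo_itv a b c & forall x, c < x -> (x%:E < b)%E -> U x%:E.
Proof.
move: ab; rewrite /oo_itv /=; case: b => [y||] //; rewrite ?lte_fin => h.
  move=> [e /= e0 eU]; exists (Num.max ((a + y) / 2) (y - e)).
    by rewrite lte_fin lt_max gt_max; split; [apply/orP; left|apply/andP; split]; lra.
  move=> x; rewrite gt_max lte_fin => /andP[_ yex] xy; apply: eU.
  by rewrite /ball_/= gtr0_norm ?subr_gt0//; lra.
move=> [M [_ MU]]; exists (Num.max (a + 1) M).
  by rewrite ltry lt_max; split=> //; apply/orP; left; lra.
by move=> x; rewrite gt_max => /andP[_ Mx] _; apply: MU; rewrite lte_fin.
Qed.

Lemma ae_at_leftP (A : set R) : ae_at_left b A ->
  exists2 c, oo_itv a b c & {ae mu, forall x, oo_itv a b x -> c < x -> A x}.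
Proof.
move=> [U /nbhs_left_endpoint[c Ic cU] UA]; exists c => //.
by apply: aeS UA => x h [_ xb] cx; apply: h => //; exact: cU.
Qed.

Lemma oo_itv_max c d : oo_itv a b c -> oo_itv a b d -> oo_itv a b (Num.max c d).
Proof. by rewrite maxEle; case: ifP. Qed.

Lemma finite_left_of (Z : set R) : finite_set Z -> Z `<=` oo_itv a b ->
  exists2 c, oo_itv a b c & forall z, Z z -> z < c.
Proof.
move=> /finite_seqP[l ->]; elim: l => [|z l IH] lI.
  by have [c Ic] := oo_itv_nonempty; exists c => // z /=; rewrite in_nil.
have [|c Ic Hc] := IH; first by move=> x xl; apply: lI; rewrite /= inE xl orbT.
have Iz : oo_itv a b z by apply: lI; rewrite /= inE eqxx.
have [e ze Ie] := oo_itv_gt (oo_itv_max Ic Iz).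
exists e => // x; rewrite /= inE => /predU1P[->|/Hc xc].
  by rewrite (le_lt_trans _ ze)// le_max lexx orbT.
by rewrite (lt_trans xc)// (le_lt_trans _ ze)// le_max lexx.
Qed.

(** If the nondecreasing primitive were bounded then, by monotone convergence along
an exhausting sequence, the integral of |g| up to b would be finite.  The absolute
value is there because monotone convergence asks for g >= 0 everywhere, and g is
known to be nonnegative almost everywhere. *)
Lemma primitive_unbounded (g : R -> R) :
  {ae mu, forall x, oo_itv a b x -> 0 <= g x} ->
  (forall x, oo_itv a b x -> mu.-integrable `]a, x[ (EFin \o g)) ->
  (forall c, oo_itv a b c -> (\int[mu]_(t in oo_itv c b) (g t)%:E = +oo)%E) ->
  forall T, exists2 c, oo_itv a b c & forall x, oo_itv a b x -> c <= x ->
    T <= \int[mu]_(t in `]a, x[) g t.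
Proof.
move=> g0 ig goo T; pose S x := \int[mu]_(t in `]a, x[) g t.
have S_mono c d : oo_itv a b c -> oo_itv a b d -> c <= d -> S c <= S d.
  move=> Ic Id cd.
  apply: (ac_derive_nondecreasing cd
    (ac_deriveS (ltW (proj1 Ic)) (lexx d) (primitive_ac_derive (ig d Id)))).
  apply: aeS g0 => x h /andP[cx xd]; apply: h; apply: oo_itv_left Id _ (ltW xd).
  by apply: lt_trans cx; case: Ic.
apply: contrapT => nex.
have ST x : oo_itv a b x -> S x < T.
  move=> Ix; rewrite ltNge; apply/negP => TS; apply: nex; exists x => // y Iy xy.
  exact: le_trans TS (S_mono _ _ Ix Iy xy).
have [c Ic] := oo_itv_nonempty; have [ac cb] := Ic.
have [e [e_mono eb e_cof]] := exhausting_sequence ab.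
pose F n := `]c, e n[%classic.
pose G t := `|g t|%:E.
have UF : \bigcup_n F n = oo_itv c b.
  apply/seteqP; split=> x /=.
    move=> [n _]; rewrite /F /= in_itv/= => /andP[cx xe]; split=> //.
    by rewrite (lt_trans _ (eb n))// lte_fin.
  by move=> [cx /e_cof[n xn]]; exists n => //; rewrite /F/= in_itv/= cx.
have iF n : mu.-integrable (F n) (EFin \o g).
  have [ce|ec] := ltP c (e n); last first.
    by rewrite /F set_itv_ge ?bnd_simp -?leNgt//; exact: integrable_set0.
  apply: integrableS (ig (e n) _) => //; first exact: measurable_itv.
    by move=> x; rewrite /F /= !in_itv/= => /andP[cx ->]; rewrite (lt_trans ac).
  by split=> //; exact: lt_trans ce.
have mG n : measurable_fun (F n) G.
  apply/measurable_EFinP; apply: measurableT_comp => //.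
  by apply/measurable_EFinP; case/integrableP: (iF n).
have boundF n : (\int[mu]_(t in F n) G t <= (T - S c)%:E)%E.
  have [ce|ec] := ltP c (e n); last first.
    rewrite /F set_itv_ge ?bnd_simp -?leNgt// integral_set0 lee_fin subr_ge0.
    exact/ltW/ST.
  have Ie : oo_itv a b (e n) by split=> //; exact: lt_trans ce.
  have -> : (\int[mu]_(t in F n) G t = \int[mu]_(t in F n) (g t)%:E)%E.
    apply: ae_eq_integral; [exact: measurable_itv|exact: mG| |].
    - by case/integrableP: (iF n).
    - apply: aeS g0 => x h; rewrite /F/= in_itv/= => /andP[cx xe].
      rewrite /G ger0_norm// h//; apply: oo_itv_left Ie _ (ltW xe).
      exact: lt_trans cx.
  have -> : (\int[mu]_(t in F n) (g t)%:E = (S (e n) - S c)%:E)%E.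
    rewrite (primitive_increment (ig _ Ie) (ltW ac) (ltW ce) (lexx _)).
    rewrite -Rintegral_oo_cc; last exact: iF.
    by rewrite /Rintegral fineK//; apply: integrable_fin_num; [exact: measurable_itv|exact: iF].
  by rewrite lee_fin lerD2r ltW// ST.
have cvgG : (\int[mu]_(t in F n) G t)%E @[n --> \oo] --> (\int[mu]_(t in oo_itv c b) G t)%E.
  rewrite -UF; apply: ge0_nondecreasing_set_cvg_integral => //.
  - apply/nondecreasing_seqP => n; apply/subsetPset => x; rewrite /F/= !in_itv/=.
    by move=> /andP[-> xe]; rewrite (lt_le_trans xe)// e_mono.
  - by move=> n; exact: measurable_itv.
  - by move=> n x _; rewrite lee_fin.
have : (\int[mu]_(t in oo_itv c b) G t <= (T - S c)%:E)%E.
  by apply: cvge_le cvgG; exact: nearW.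
have mI : measurable (oo_itv c b).
  by rewrite -UF; apply: bigcup_measurable => n _; exact: measurable_itv.
have mg : measurable_fun (oo_itv c b) (EFin \o g).
  rewrite -UF; apply/measurable_fun_bigcup; first by move=> n; exact: measurable_itv.
  by move=> n; case/integrableP: (iF n).
have : (+oo <= \int[mu]_(t in oo_itv c b) G t)%E.
  rewrite -(goo c Ic); apply: (le_trans _ (le_abse_integral mu mI mg)).
  exact: lee_abs.
by rewrite leye_eq => /eqP ->.
Qed.

Lemma limf_einf_gt (f : R -> R) (F : set_system R) t :
  (t%:E < limf_einf (fun x => (f x)%:E) F)%E ->
  exists2 V, F V & exists2 k, 0 < k & forall x, V x -> t + k <= f x.
Proof.
rewrite limf_einfE => /ereal_sup_gt[_ [V FV <-]] tV; exists V => //.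
have Vf x : V x -> (ereal_inf [set (f x)%:E | x in V] <= (f x)%:E)%E.
  by move=> Vx; apply: ereal_inf_lbound; exists x.
move: tV Vf; case: (ereal_inf _) => [y||] // ty Vf.
  exists (y - t); first by rewrite subr_gt0 -lte_fin.
  by move=> x /Vf; rewrite lee_fin addrC subrK.
by exists 1 => // x /Vf; rewrite leye_eq.
Qed.

Lemma limf_esup_lt (f : R -> R) (F : set_system R) t :
  (limf_esup (fun x => (f x)%:E) F < t%:E)%E ->
  exists2 V, F V & exists2 k, 0 < k & forall x, V x -> f x <= t - k.
Proof.
rewrite limf_esupE => /ereal_inf_lt[_ [V FV <-]] tV; exists V => //.
have Vf x : V x -> ((f x)%:E <= ereal_sup [set (f x)%:E | x in V])%E.
  by move=> Vx; apply: ereal_sup_ubound; exists x.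
move: tV Vf; case: (ereal_sup _) => [y||] // ty Vf.
  exists (t - y); first by rewrite subr_gt0 -lte_fin.
  by move=> x /Vf; rewrite lee_fin opprB addrC subrK.
by exists 1 => // x /Vf; rewrite leeNy_eq.
Qed.

End Endpoint.

(** * The two criteria *)
Section Criteria.
Context {R : realType}.
Local Notation mu := (@lebesgue_measure R).
Variables (a : R) (b : \bar R) (p0 q0 p1 q1 r u0 w0 s : R -> R) (E : R) (n : nat).
Hypothesis ab : (a%:E < b)%E.
Hypothesis coef0 : sl_coefficients a b p0 q0 r.
Hypothesis coef1 : sl_coefficients a b p1 q1 r.
Hypothesis u0_gt0 : forall x, oo_itv a b x -> 0 < u0 x.
Hypothesis sol0 : solution_pair a b p0 q0 r E u0 w0.

Let Dp x := (p0 x)^-1 - (p1 x)^-1.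
Let Dq x := q1 x - q0 x.
Let A x := p0 x * Dp x.
Let B x := p0 x * u0 x * w0 x * Dp x.
Let C x := p0 x * u0 x ^+ 2 * (u0 x ^+ 2 * Dq x + w0 x ^+ 2 * Dp x).
Let L x := Llog n (s x).

Hypothesis ac_s : forall c d, a < c -> (d%:E < b)%E ->
  ac_derive c d s (fun x => (p0 x * u0 x ^+ 2)^-1).
Hypothesis s_unbounded : forall T, exists2 c, oo_itv a b c &
  forall x, oo_itv a b x -> c <= x -> T <= s x.
Hypothesis small : forall eps, 0 < eps -> exists2 c, oo_itv a b c &
  {ae mu, forall x, oo_itv a b x -> c < x ->
    `|A x| <= eps * (s x ^+ 2 / L x ^+ 2) /\
    `|s x * B x| <= eps * (s x ^+ 2 / L x ^+ 2)}.

Let p0_gt0 : {ae mu, forall x, oo_itv a b x -> 0 < p0 x}.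
Proof. by case: coef0 => h _; apply: aeS h => x h /h[]. Qed.

Let p1_gt0 : {ae mu, forall x, oo_itv a b x -> 0 < p1 x}.
Proof. by case: coef1 => h _; apply: aeS h => x h /h[]. Qed.

Let small_large eps : 0 < eps -> exists2 c, oo_itv a b c &
  (forall x, oo_itv a b x -> c <= x -> log_large n (s x)) /\
  {ae mu, forall x, oo_itv a b x -> c < x ->
    `|A x| <= eps * (s x ^+ 2 / L x ^+ 2) /\ `|B x| <= eps * (s x / L x ^+ 2)}.
Proof.
move=> e0; have [c Ic Hc] := small e0.
have [T HT] := log_large_near (R := R) n; have [c' Ic' Hc'] := s_unbounded T.
exists (Num.max c c'); first exact: oo_itv_max.
have large x : oo_itv a b x -> Num.max c c' <= x -> log_large n (s x).
  by rewrite ge_max => Ix /andP[_ cx]; apply/HT/Hc'.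
split=> //; apply: aeS Hc => x h Ix cx.
have s1 := log_large_ge1 (large x Ix (ltW cx)).
have s0 : 0 < s x by exact: lt_le_trans s1.
move: cx; rewrite gt_max => /andP[cx _].
have [hA hB] := h Ix cx; split=> //.
rewrite -(ler_pM2l s0) -{1}(gtr0_norm s0) -normrM (le_trans hB)//.
by rewrite le_eqVlt; apply/orP; left; apply/eqP; rewrite expr2; ring.
Qed.

(** The solution is prescribed at a point x0 close to b by Y = 1 and
Z - psi Y = 1; their product is then at least 1 to the right of x0. *)
Lemma nonoscillation_criterion k : regular_left a b p1 q1 r -> 0 < k ->
  (exists2 c, oo_itv a b c & {ae mu, forall x, oo_itv a b x -> c < x ->
     - 4^-1 + k <= L x ^+ 2 * (C x - Qlog n (s x))}) ->
  nonoscillatory a b p1 q1 r E.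
Proof.
move=> reg1 k0 [c1 Ic1 HC]; pose N : R := n.+1%:R.
have M0 : 0 < 2 * N + N ^+ 2 by rewrite addr_gt0 ?mulr_gt0 ?exprn_gt0.
have [c Ic [large smallAB]] := small_large (divr_gt0 k0 M0).
pose x0 := Num.max c c1; have Ix0 : oo_itv a b x0 by exact: oo_itv_max.
have cx0 : c <= x0 by rewrite le_max lexx.
have c1x0 : c1 <= x0 by rewrite le_max lexx orbT.
have large0 x : oo_itv a b x -> x0 <= x -> log_large n (s x).
  by move=> Ix x0x; apply: large => //; exact: le_trans x0x.
pose psi x := psi_log n.+1 (s x).
have u0x0 := u0_gt0 Ix0.
(* The value of w for which Z - psi Y = 1 when Y = 1. *)
pose z0 := (1 + psi x0) / u0 x0 + w0 x0.
have [|u [w [sol1 ux0 wx0 zeros]]] :=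
  solution_exists (y0 := u0 x0) (z0 := z0) E coef1 reg1 Ix0.
  by rewrite gt_eqF.
have Yx0 : u x0 / u0 x0 = 1 by rewrite ux0 divff// gt_eqF.
have Wx0 : u0 x0 * w x0 - w0 x0 * u x0 - psi x0 * (u x0 / u0 x0) = 1.
  by rewrite Yx0 ux0 wx0 /z0; field; rewrite gt_eqF.
have prod_ge d : oo_itv a b d -> x0 <= d ->
    1 <= u d / u0 d * (u0 d * w d - w0 d * u d - psi d * (u d / u0 d)).
  move=> Id x0d; apply: le_trans
    (nonvanishing_product p0_gt0 p1_gt0 u0_gt0 sol0 sol1 ac_s Ix0 large0 _ Id x0d).
    by rewrite -/(psi x0) Wx0 Yx0 mulr1.
  apply: aeS2 smallAB HC => x h1 h2 Ix x0x.
  have [hA hB] := h1 Ix (le_lt_trans cx0 x0x).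
  have lx := large0 x Ix (ltW x0x).
  have hC := h2 Ix (le_lt_trans c1x0 x0x).
  rewrite Qlog_S; apply: (comparison_lower (log_large_ge1 lx) (Llog_ge lx)
    (psi_log_ge0 (leqnn _) lx) (psi_log_le (leqnn _) lx) hA hB _ hC).
  by rewrite divfK// gt_eqF.
have un0 d : oo_itv a b d -> x0 <= d -> u d != 0.
  move=> Id x0d; apply/negP => /eqP ud0; have := prod_ge d Id x0d.
  by rewrite ud0 !mul0r ler10.
exists u; split.
- exact: solution_pair_sl coef1 sol1.
- by exists x0 => //; rewrite un0.
- apply: sub_finite_set (zeros x0 Ix0) => x [Ix ux]; split=> //.
  rewrite ltW /=; last by case: Ix.
  by rewrite leNgt; apply/negP => /ltW /(un0 x Ix); rewrite ux eqxx.
Qed.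

(** A solution with finitely many zeros has none near b, where riccati_atan_bound
bounds log_{n+1}(s), contradicting that s is unbounded. *)
Lemma oscillation_criterion k : 0 < k ->
  (exists2 c, oo_itv a b c & {ae mu, forall x, oo_itv a b x -> c < x ->
     L x ^+ 2 * (C x - Qlog n (s x)) <= - 4^-1 - k}) ->
  oscillatory a b p1 q1 r E.
Proof.
move=> k0 [c1 Ic1 HC] [u [slu _ fin]]; pose N : R := n.+1%:R.
have [w sol1 _] := sl_solutionP coef1 slu.
have [c2 Ic2 Hc2] := finite_left_of ab fin (fun x h => proj1 h).
pose m := Num.min k 1 / 2.
have m0 : 0 < m by rewrite divr_gt0// lt_min k0 ltr01.
have mE : 2 * m = Num.min k 1 by rewrite /m mulrCA divff// mulr1.
have M0 : 0 < N ^+ 2 + 3 * N + 2 by rewrite !addr_gt0 ?mulr_gt0 ?exprn_gt0.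
have [c Ic [large smallAB]] := small_large (divr_gt0 m0 M0).
pose x0 := Num.max c (Num.max c1 c2).
have Ix0 : oo_itv a b x0 by do !apply: oo_itv_max.
have [cx0 c1x0 c2x0] : [/\ c <= x0, c1 <= x0 & c2 <= x0].
  by rewrite /x0 !le_max !lexx !orbT.
have large0 x : oo_itv a b x -> x0 <= x -> log_large n (s x).
  by move=> Ix x0x; apply: large => //; exact: le_trans x0x.
have un0 x : oo_itv a b x -> x0 <= x -> u x != 0.
  move=> Ix x0x; apply/negP => /eqP ux.
  by have := Hc2 x (conj Ix ux); rewrite ltNge (le_trans c2x0).
have bound := riccati_atan_bound p0_gt0 p1_gt0 u0_gt0 sol0 sol1 ac_s Ix0 large0 m0 un0.
have [T HT] := iterlog_ge n.+1 (iterlog n.+1 (s x0) + pi / m + 1).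
have [c3 Ic3 Hc3] := s_unbounded T.
pose d := Num.max x0 c3; have Id : oo_itv a b d by exact: oo_itv_max.
have := HT (s d) (Hc3 d Id _); rewrite le_max lexx orbT => /(_ isT).
apply/negP; rewrite -ltNge -(ltr_pM2l m0).
apply: (@le_lt_trans _ _ (m * iterlog n.+1 (s x0) + pi)); last first.
  by rewrite !mulrDr mulrCA divff ?gt_eqF// !mulr1 ltrDl.
apply: bound => //; last by rewrite le_max lexx.
apply: aeS2 smallAB HC => x h1 h2 Ix x0x h.
have [hA hB] := h1 Ix (le_lt_trans cx0 x0x).
have lx := large0 x Ix (ltW x0x).
have hC := h2 Ix (le_lt_trans c1x0 x0x).
rewrite Qlog_S; apply: (comparison_upper (log_large_ge1 lx) (Llog_ge lx)
    (psi_log_ge0 (leqnn _) lx) (psi_log_le (leqnn _) lx) hA hB h _ _ _ hC).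
- by rewrite divfK// gt_eqF.
- by rewrite mE ge_min lexx.
- by rewrite mE ge_min lexx orbT.
Qed.

End Criteria.

Theorem theorem2p4 (R : realType) (a : R) (b : \bar R)
    (p0 q0 p1 q1 r u0 : R -> R) (E : R) (n : nat)
    (hab : (a%:E < b)%E)
    (hc0 : sl_coefficients a b p0 q0 r) (hc1 : sl_coefficients a b p1 q1 r)
    (ha0 : regular_left a b p0 q0 r) (ha1 : regular_left a b p1 q1 r)
    (hb0 : limit_point_right a b p0 q0 r) (hb1 : limit_point_right a b p1 q1 r)
    (hu0 : minimal_positive_solution a b p0 q0 r E u0)
    (* the integral defining v0 converges *)
    (hv0 : forall x, oo_itv a b x ->
       (@lebesgue_measure R).-integrable `]a, x[
         (fun t => ((p0 t * u0 t ^+ 2)^-1)%:E)) :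
  let Dp : R -> R^o := fun x => (p0 x)^-1 - (p1 x)^-1 in
  let Dq : R -> R^o := fun x => q1 x - q0 x in
  let pu0 : R -> R^o := fun x => p0 x * derive1 u0 x in
  let v0 := second_solution a p0 u0 in
  let s : R -> R := fun x => v0 x / u0 x in
  let rhs : R -> R^o := fun x => s x ^+ 2 / Llog n (s x) ^+ 2 in
  let crit : R -> R := fun x =>
    Llog n (s x) ^+ 2 *
      (p0 x * u0 x ^+ 2 * (u0 x ^+ 2 * Dq x + pu0 x ^+ 2 * Dp x)
       - Qlog n (s x)) in
  ((fun x => p0 x * v0 x * pu0 x * Dp x) : R -> R^o) =o_ (ae_at_left b) rhs ->
  ((fun x => p0 x * Dp x) : R -> R^o) =o_ (ae_at_left b) rhs ->
  ((limf_esup (fun x => (crit x)%:E) (ae_at_left b) < (- (1 / 4))%:E)%E ->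
     oscillatory a b p1 q1 r E) /\
  (((- (1 / 4))%:E < limf_einf (fun x => (crit x)%:E) (ae_at_left b))%E ->
     nonoscillatory a b p1 q1 r E).
Proof.
move=> Dp Dq pu0 v0 s rhs crit small1 small2.
have [sl0 u0_gt0 u0_min] := hu0.
have [w0 sol0 w0E] := sl_solutionP hc0 sl0.
pose sg x := (p0 x * u0 x ^+ 2)^-1.
have sE x : oo_itv a b x -> s x = \int[lebesgue_measure]_(t in `]a, x[) sg t.
  by move=> Ix; rewrite /s /v0 /second_solution mulrC mulKf// gt_eqF// u0_gt0.
have ac_s c d : a < c -> (d%:E < b)%E -> ac_derive c d s sg.
  move=> ac db; have [e0 Ie0] := oo_itv_nonempty hab.
  pose e := Num.max e0 d.
  have Ie : oo_itv a b e.
    have [ae0 _] := Ie0; rewrite /e maxEle; case: ifP => [e0d|//].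
    by split=> //; exact: lt_le_trans e0d.
  have de : d <= e by rewrite /e le_max lexx orbT.
  apply: ac_derive_eq (ac_deriveS (ltW ac) de (primitive_ac_derive (hv0 e Ie))).
  by move=> x /andP[cx xd]; rewrite sE//; apply: oo_itv_left Ie (lt_le_trans ac cx) (le_trans xd de).
have sg_ge0 : {ae lebesgue_measure, forall x, oo_itv a b x -> 0 <= sg x}.
  case: hc0 => pos _; apply: aeS pos => x h /h[px _].
  by rewrite invr_ge0 mulr_ge0 ?sqr_ge0// ltW.
have s_unbounded T : exists2 c, oo_itv a b c & forall x, oo_itv a b x -> c <= x -> T <= s x.
  have [c Ic Hc] := primitive_unbounded hab sg_ge0 hv0 u0_min T.
  by exists c => // x Ix cx; rewrite sE// Hc.
have small eps : 0 < eps -> exists2 c, oo_itv a b c &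
    {ae lebesgue_measure, forall x, oo_itv a b x -> c < x ->
    `|p0 x * Dp x| <= eps * (s x ^+ 2 / Llog n (s x) ^+ 2) /\
    `|s x * (p0 x * u0 x * w0 x * Dp x)| <= eps * (s x ^+ 2 / Llog n (s x) ^+ 2)}.
  move=> e0; have [c Ic Hc] := ae_at_leftP hab
     (filterI (iffLR (eqoP _ _ _) small1 eps e0) (iffLR (eqoP _ _ _) small2 eps e0)).
  exists c => //; apply: aeS2 Hc w0E => x h w0x Ix cx.
  have [h1 h2] := h Ix cx.
  have rhs0 : `|rhs x| = s x ^+ 2 / Llog n (s x) ^+ 2.
    by rewrite ger0_norm// divr_ge0 ?sqr_ge0.
  rewrite -rhs0; split=> //.
  (* v0 = s u0, and w0 = p0 u0' at almost every point. *)
  suff -> : s x * (p0 x * u0 x * w0 x * Dp x) = p0 x * v0 x * pu0 x * Dp x by [].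
  rewrite w0x// /pu0 /s; field.
  by rewrite gt_eqF// u0_gt0.
split.
- move=> /limf_esup_lt[V /(ae_at_leftP hab)[c Ic HV] [k k0 Hk]].
  apply: (oscillation_criterion hab hc0 hc1 u0_gt0 sol0 ac_s s_unbounded small k0).
  exists c => //; apply: aeS2 HV w0E => x h w0x Ix cx.
  by have := Hk x (h Ix cx); rewrite /crit /pu0 -w0x// div1r.
- move=> /limf_einf_gt[V /(ae_at_leftP hab)[c Ic HV] [k k0 Hk]].
  apply: (nonoscillation_criterion hc0 hc1 u0_gt0 sol0 ac_s s_unbounded small ha1 k0).
  exists c => //; apply: aeS2 HV w0E => x h w0x Ix cx.
  by have := Hk x (h Ix cx); rewrite /crit /pu0 -w0x// div1r.
Qed.
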